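(* Let $(X_i)_{i\ge1}$, $(Y_i)_{i\ge1}$ satisfy assumptions A1, A2 and A3 (stated in the context), with $\gamma_0>0$ the constant in A3. Let $t(n)=n^{\beta}$ and $s(n)=n^{-c}$ with $0<\beta<\gamma_0/2$ and $\beta/\gamma_0<c<1/2$, and let $H_n=\frac{1}{\log\log n}$. Then, as $n\to\infty$, $$\frac{\widehat\zeta}{\widehat\rho}\,\mathbf 1_{\widehat\rho\ge H_n}\to\gamma_X\quad\text{almost surely.}$$
   Context: Setting. $X_i$ are real random variables (''data'') and $Y_i$ are real random variables (''censoring times''). The tail function of a random variable $K$ is $P_K(x)=\mathrm{Prob}(K>x)$. A1: the $X_i$ are i.i.d., the $Y_i$ are i.i.d., and all the variables $X_i,Y_i$ are mutually independent. For all $x\ge a$ (some $a>0$), $P_X(x)=L_X(x)x^{-\alpha_X}$ and $P_Y(x)=L_Y(x)x^{-\alpha_Y}$, with $\alpha_X,\alpha_Y>0$ and $L_X,L_Y$ positive slowly varying functions at infinity. The tail indices are $\gamma_X=1/\alpha_X$, $\gamma_Y=1/\alpha_Y$. A2: $L_X,L_Y$ are differentiable on $(a,\infty)$ and there is $\kappa>0$ such that for $K=X,Y$, $\left|\frac{xL_K'(x)}{L_K(x)}\right|=O\left(\frac{1}{\log^{\kappa}x}\right)$ as $x\to\infty$. A3: there is a known constant $\gamma_0>0$ with $\gamma_X\ge 2\gamma_0$ and $\gamma_Y\ge 2\gamma_0$. Observations and estimators. One observes $Z_i=\min(X_i,Y_i)$ and $\delta_i=\mathbf 1_{X_i\le Y_i}$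 for $i=1,\dots,n$. For $x>0$, $$\widehat p(x)=\frac1n\sum_{i=1}^n\mathbf 1_{Z_i\ge x},\qquad \widehat q(x)=\frac1n\sum_{i=1}^n\delta_i\mathbf 1_{Z_i\ge x},$$ $$\widehat\rho=\frac{\widehat q(t(n))}{\widehat p(t(n))}\mathbf 1_{\widehat p(t(n))\ge s(n)},\qquad \widehat\zeta=\frac{\mathbf 1_{\widehat p(t(n))\ge s(n)}}{\widehat p(t(n))}\int_{t(n)}^\infty\frac{\widehat p(y)}{y}\,dy=\frac{\mathbf 1_{\widehat p(t(n))\ge s(n)}}{n\,\widehat p(t(n))}\sum_{i=1}^n\log\left(\frac{Z_i}{t(n)}\right)\mathbf 1_{Z_i\ge t(n)}.$$ Convention: $\infty\times0=0$, i.e. any expression multiplied by an indicator equal to $0$ is $0$. *)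

(* Defs.v *)
From mathcomp Require Import all_boot all_order all_algebra.
From mathcomp Require Import all_classical all_reals all_analysis.

Set Implicit Arguments.
Unset Strict Implicit.
Unset Printing Implicit Defensive.

Import Order.TTheory GRing.Theory Num.Theory.
Import numFieldNormedType.Exports.

Local Open Scope classical_set_scope.
Local Open Scope ring_scope.

Section Sampling.
Context (d : measure_display) (T : measurableType d) (R : realType)
  (P : probability T R).

(* Mutual independence: the product rule over every finite subfamily, each
   finite set of indices being listed without repetition by J. *)
Definition mutually_independent (I : eqType) (X : I -> {RV P >-> R}) : Prop :=
  forall (J : seq I) (A : I -> set R), uniq J ->
    (forall j, measurable (A j)) ->
    P (\bigcap_(j in [set` J]) (X j @^-1` A j)) =
    (\prod_(j <- J) P (X j @^-1` A j))%E.

Definition identically_distributed (I : Type) (X : I -> {RV P >-> R}) : Prop :=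
  forall (i j : I) (A : set R), measurable A ->
    distribution P (X i) A = distribution P (X j) A.

Definition joint_family (X Y : nat -> {RV P >-> R}) (k : nat + nat) :
    {RV P >-> R} :=
  match k with inl i => X i | inr i => Y i end.

End Sampling.

Canonical pinfty_filter_on (R : numFieldType) : filter_on R :=
  FilterType (pinfty_nbhs R) proper_pinfty_nbhs.

Section Tails.
Context (R : realType).

Definition slowly_varying (a : R) (L : R -> R) : Prop :=
  [/\ measurable_fun `[a, +oo[ L,
      forall x, a <= x -> 0 < L x &
      forall lambda : R, 0 < lambda ->
        L (lambda * x) / L x @[x --> +oo] --> (1 : R)].

Definition regular_tail (d : measure_display) (T : measurableType d)
    (P : probability T R) (K : {RV P >-> R}) (a alpha : R) (L : R -> R) : Prop :=
  [/\ 0 < alpha, slowly_varying a L &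
      forall x, a <= x -> ccdf K x = (L x * x `^ (- alpha))%:E].

Definition log_derivative_bound (L : R -> R) (kappa : R) : Prop :=
  (fun x : R => `|x * L^`()%classic x / L x|) =O_ (pinfty_nbhs R)
  (fun x : R => 1 / (ln x `^ kappa)).

Definition tail_index (alpha : R) : R := 1 / alpha.

End Tails.

Section Assumptions.
Context (d : measure_display) (T : measurableType d) (R : realType)
  (P : probability T R).

Definition A1 (X Y : nat -> {RV P >-> R}) (a alphaX alphaY : R)
    (LX LY : R -> R) : Prop :=
  [/\ identically_distributed X, identically_distributed Y,
      mutually_independent (joint_family X Y) &
      [/\ 0 < a, regular_tail (X 0%N) a alphaX LX &
          regular_tail (Y 0%N) a alphaY LY]].

Definition A2 (a : R) (LX LY : R -> R) : Prop :=
  (forall x, a < x -> derivable LX x 1 /\ derivable LY x 1) /\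
  exists kappa : R, [/\ 0 < kappa,
    log_derivative_bound LX kappa & log_derivative_bound LY kappa].

Definition A3 (gamma0 alphaX alphaY : R) : Prop :=
  [/\ 0 < gamma0, 2 * gamma0 <= tail_index alphaX &
      2 * gamma0 <= tail_index alphaY].

End Assumptions.

(* The sample of size n consists of the indices 0, ..., n - 1. The field
   convention x / 0 = 0 makes every expression below total, so that a factor
   whose indicator vanishes is 0 whatever it multiplies. *)
Section Estimators.
Context (T : Type) (R : realType) (X Y : nat -> T -> R).

Definition observed (i : nat) (w : T) : R := Num.min (X i w) (Y i w).

Definition uncensored (i : nat) (w : T) : R := (X i w <= Y i w)%R%:R.

Definition phat (n : nat) (x : R) (w : T) : R :=
  1 / n%:R * \sum_(i < n) (x <= observed i w)%R%:R.

Definition qhat (n : nat) (x : R) (w : T) : R :=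
  1 / n%:R * \sum_(i < n) uncensored i w * (x <= observed i w)%R%:R.

Definition rhohat (t s : nat -> R) (n : nat) (w : T) : R :=
  qhat n (t n) w / phat n (t n) w * (s n <= phat n (t n) w)%R%:R.

(* The integrand is bounded and vanishes beyond the largest observation, so
   the real-valued integral is not truncated. *)
Definition zetahat (t s : nat -> R) (n : nat) (w : T) : R :=
  (s n <= phat n (t n) w)%R%:R / phat n (t n) w *
  \int[lebesgue_measure]_(y in `[t n, +oo[) (phat n y w / y).

End Estimators.

Definition threshold (R : realType) (beta : R) (n : nat) : R := n%:R `^ beta.

Definition floor_level (R : realType) (c : R) (n : nat) : R := n%:R `^ (- c).

Definition H_seq (R : realType) (n : nat) : R := 1 / ln (ln n%:R).

(* Main.v *)
Require Import Defs.
From mathcomp Require Import all_boot all_order all_algebra.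
From mathcomp Require Import all_classical all_reals all_analysis.
From mathcomp Require Import measurable_realfun ring lra.
Import Order.TTheory GRing.Theory Num.Theory.
Import numFieldNormedType.Exports.
Local Open Scope classical_set_scope.
Local Open Scope ring_scope.

(** Write p(x) = P(X >= x) P(Y >= x), alpha = alphaX + alphaY and
    t_n = n^beta. As long as the indicators equal 1, the factors phat cancel
    and the estimator is the quotient L / M of
      M = sum over i < n of 1{t_n <= X_i <= Y_i} and
      L = sum over i < n of log^+(min(X_i, Y_i) / t_n),
    because 1{y <= z} / y integrates to log^+(z / t) over [t, +oo[
    ([Rintegral_exceedances]). Almost surely M / (n p(t_n)) tends to
    alphaX / alpha and L / (n p(t_n)) tends to 1 / alpha, and the quotient of
    these limits is 1 / alphaX.

    Both sums are compared with the numbers of sample points in the quadrants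
    X >= t_n e^(jh), Y >= t_n e^(kh) of a geometric grid. On the event X <= Y,
    the indicator of X >= t is a telescoping sum over the grid, and log^+(z/t)
    is within h of h times the number of grid levels below z. Quadrants are
    rectangles, so the law of their counts follows from the product rule
    alone. Regular variation makes the count of a quadrant, divided by
    n p(t_n), tend to e^(-(alphaX j + alphaY k) h) ([ae_grid_limit]). The
      resulting geometric
    sums bound M and L from both sides, and the bounds meet as h tends to 0
    ([cvg_uncensored_count], [cvg_log_excess_sum]).

    The strong law behind [ae_grid_limit] must hold along moving thresholds.
    A count of n independent events of probability r is binomial, with fourth
    central moment at most 3 (nr)^2 + nr. Hence a deviation of eps n p(t_n) has
    probability O((n p(t_n))^-2). A3 and beta / gamma0 < c give
    beta alpha < c, so that n p(t_n) >= n^(1 - c) eventually, and c < 1/2 makes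
    these probabilities summable: Borel-Cantelli applies without passing to
      subsequences. The sum
    L involves arbitrarily high levels of the grid; [ae_grid_tail] bounds all
    of them at once by a geometric sequence, with a deviation allowed at level
    k that decreases slowly enough for the union bound to converge. *)

Set Implicit Arguments.
Unset Strict Implicit.
Unset Printing Implicit Defensive.

(** * Fourth central moment of the binomial law *)
Section Binomial.
Context (R : realType).

(** The probability of m successes in n trials, given by its recursion on the
    first trial because both uses below proceed by that recursion. *)
Fixpoint binom_law (r : R) (n m : nat) : R :=
  match n, m with
  | 0%N, 0%N => 1
  | 0%N, _.+1 => 0
  | n.+1, 0%N => (1 - r) * binom_law r n 0
  | n.+1, m.+1 => r * binom_law r n m + (1 - r) * binom_law r n m.+1
  end.

Lemma binom_law_ge0 r n m : 0 <= r <= 1 -> 0 <= binom_law r n m.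
Proof.
move=> /andP[r0 r1].
elim: n m => [|n IH] [|m] //=; rewrite ?addr_ge0 ?mulr_ge0 ?subr_ge0//.
Qed.

Lemma binom_law_gt r n m : (n < m)%N -> binom_law r n m = 0.
Proof.
elim: n m => [|n IH] [|m] //= nm.
by rewrite !IH ?mulr0 ?addr0// ltnW.
Qed.

Lemma sum_binom_lawS r n (g : nat -> R) :
  \sum_(m < n.+2) binom_law r n.+1 m * g m =
  r * \sum_(m < n.+1) binom_law r n m * g m.+1 +
  (1 - r) * \sum_(m < n.+1) binom_law r n m * g m.
Proof.
rewrite big_ord_recl/=.
under eq_bigr => i _ do rewrite mulrDl.
rewrite big_split/= addrCA; congr (_ + _).
  by rewrite mulr_sumr; apply: eq_bigr => i _; rewrite mulrA.
rewrite big_ord_recr/= (@binom_law_gt r n (0 + n).+1) ?add0n//;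
  rewrite mulr0 mul0r addr0.
rewrite [in RHS]big_ord_recl/= mulrDr mulrA; congr (_ + _).
by rewrite mulr_sumr; apply: eq_bigr => i _; rewrite mulrA.
Qed.

(** The translation by c makes the induction on n go through: the law of
    n + 1 trials is a mixture of translates of the law of n trials, so the
    moment for c is a combination of those for c - r and c + 1 - r. *)
Lemma binom_law_moment4 r n (c : R) :
  \sum_(m < n.+1) binom_law r n m * (c + (m%:R - n%:R * r)) ^+ 4 =
  let v := r * (1 - r) in
  c ^+ 4 + 6 * c ^+ 2 * (n%:R * v) + 4 * c * (n%:R * (v * (1 - 2 * r))) +
  3 * n%:R * (n%:R - 1) * v ^+ 2 + n%:R * (v * (1 - 3 * v)).
Proof.
elim: n c => [|n IH] c /=.
  by rewrite big_ord_recl big_ord0/=; ring.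
rewrite (sum_binom_lawS r n (fun m => (c + (m%:R - n.+1%:R * r)) ^+ 4)).
have -> : \sum_(m < n.+1) binom_law r n m * (c + (m.+1%:R - n.+1%:R * r)) ^+ 4
  = \sum_(m < n.+1) binom_law r n m * (c + 1 - r + (m%:R - n%:R * r)) ^+ 4.
  by apply: eq_bigr => m _; congr (_ * _ ^+ 4); rewrite -!natr1; ring.
have -> : \sum_(m < n.+1) binom_law r n m * (c + (m%:R - n.+1%:R * r)) ^+ 4
  = \sum_(m < n.+1) binom_law r n m * (c - r + (m%:R - n%:R * r)) ^+ 4.
  by apply: eq_bigr => m _; congr (_ * _ ^+ 4); rewrite -!natr1; ring.
by rewrite !IH/= -!natr1; ring.
Qed.

Lemma binom_law_moment4_le r n : 0 <= r <= 1 ->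
  \sum_(m < n.+1) binom_law r n m * (m%:R - n%:R * r) ^+ 4 <=
  3 * (n%:R * r) ^+ 2 + n%:R * r.
Proof.
move=> /andP[r0 r1].
have -> : \sum_(m < n.+1) binom_law r n m * (m%:R - n%:R * r) ^+ 4 =
  \sum_(m < n.+1) binom_law r n m * (0 + (m%:R - n%:R * r)) ^+ 4.
  by apply: eq_bigr => m _; rewrite add0r.
rewrite binom_law_moment4/=.
have n0 : 0 <= n%:R :> R by [].
set v := r * (1 - r).
have v0 : 0 <= v by rewrite mulr_ge0 ?subr_ge0.
have vr : v <= r by rewrite ler_piMr// lerBlDr lerDl.
have h1 : n%:R * (n%:R - 1) * v ^+ 2 <= (n%:R * r) ^+ 2.
  rewrite [leRHS]exprMn ler_pM ?sqr_ge0//.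
  - by case: n n0 => [|n] _; rewrite ?mul0r// -natr1 addrK mulr_ge0.
  - by rewrite expr2 ler_wpM2l// lerBlDr lerDl.
  - by rewrite lerXn2r ?nnegrE.
have h2 : n%:R * (v * (1 - 3 * v)) <= n%:R * r.
  rewrite ler_wpM2l// (le_trans _ vr)// ler_piMr// lerBlDr lerDl mulr_ge0//.
by rewrite -!mulrA in h1 h2 *; lra.
Qed.

End Binomial.

(** * Counts of independent events *)
Section Deviation.
Context d (T : measurableType d) (R : realType) (P : probability T R).
Variables (E : nat -> set T) (r : R).
Hypothesis mE : forall i, measurable (E i).
Hypothesis indepE : forall J : seq nat, uniq J ->
  P (\bigcap_(j in [set` J]) E j) = (r ^+ size J)%:E.

Definition occurrences (L : seq nat) (w : T) : nat :=
  count (fun i => `[< E i w >]) L.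

Let cylinder (J L : seq nat) (m : nat) := (\bigcap_(j in [set` J]) E j) `&`
  [set w | occurrences L w = m].

Lemma measurable_occurrences L m : measurable [set w | occurrences L w = m].
Proof.
elim: L m => [|i L IH] m.
  have [->|m0] := eqVneq m 0%N.
    by rewrite (_ : [set _ | _] = setT)//; apply/seteqP; split => // w.
  rewrite (_ : [set _ | _] = set0)//; apply/seteqP; split => // w /=.
  by move=> /esym m0'; rewrite m0' eqxx in m0.
rewrite (_ : [set _ | _] =
  (E i `&` [set w | (occurrences L w).+1 = m]) `|`
  (~` E i `&` [set w | occurrences L w = m])); last first.
  apply/seteqP; split => w /=; rewrite /occurrences/=.
    case: asboolP => //= Eiw <-; [by left|by right].
  by move=> [[Eiw <-]|[Eiw <-]]; case: asboolP.
apply: measurableU; apply: measurableI => //; last exact: measurableC.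
case: m => [|m].
  by rewrite (_ : [set _ | _] = set0)//; apply/seteqP; split.
rewrite (_ : [set _ | _] = [set w | occurrences L w = m])//.
by apply/seteqP; split => w /=; [move=> []|move=> ->].
Qed.

Lemma measurable_cylinder J L m : measurable (cylinder J L m).
Proof.
apply: measurableI; last exact: measurable_occurrences.
exact: fin_bigcap_measurable.
Qed.

(** Keeping a second list J of events that are required to occur makes the
    product rule for intersections sufficient: the case where event i fails is
    the difference between imposing nothing on i and moving i into J. *)
Lemma cylinder_law J L m : uniq (J ++ L) ->
  P (cylinder J L m) = (r ^+ size J * binom_law r (size L) m)%:E.
Proof.
elim: L J m => [|i L IH] J m.
  rewrite cats0 => uJ; case: m => [|m]/=.
    rewrite mulr1 -(indepE uJ); congr (P _); rewrite /cylinder.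
    by apply/seteqP; split => w // [].
  rewrite mulr0 (_ : cylinder _ _ _ = set0) ?measure0//.
  by apply/seteqP; split => w // [].
move=> uJiL.
have uiJL : uniq ((i :: J) ++ L) by move: uJiL; rewrite -cat1s uniq_catCA.
have uJL : uniq (J ++ L) by case/andP: uiJL.
have capU : \bigcap_(j in [set` i :: J]) E j =
    E i `&` \bigcap_(j in [set` J]) E j.
  apply/seteqP; split => w /=.
    move=> Ew; split; first by apply: Ew; rewrite /= inE eqxx.
    by move=> j jJ; apply: Ew; rewrite /= inE jJ orbT.
  move=> [Eiw EJw] j /=; rewrite inE => /predU1P[->//|jJ]; exact: EJw.
have cylC k : P (cylinder J L k `&` ~` E i) =
    ((r ^+ size J) * ((1 - r) * binom_law r (size L) k))%:E.
  have -> : P (cylinder J L k `&` ~` E i) =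
      (P (cylinder J L k) - P (cylinder J L k `&` E i))%E.
    apply: measureD => //; first exact: measurable_cylinder.
    by rewrite ltey_eq fin_num_measure//; exact: measurable_cylinder.
  rewrite (_ : _ `&` E i = cylinder (i :: J) L k); last first.
    by rewrite /cylinder capU setIC setIA.
  rewrite !IH// -EFinB; congr EFin; rewrite /= exprS; ring.
case: m => [|m]/=.
  rewrite (_ : cylinder _ _ _ = cylinder J L 0 `&` ~` E i).
    by rewrite cylC.
  rewrite /cylinder/occurrences; apply/seteqP; split => w /=.
    by move=> [? ]; case: asboolP.
  by move=> [[? ->]]; case: asboolP.
rewrite (_ : cylinder _ _ _ = cylinder (i :: J) L m `|`
    (cylinder J L m.+1 `&` ~` E i)); last first.
  rewrite /cylinder capU /occurrences; apply/seteqP; split => w /=.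
    move=> [? ]; case: asboolP => Ei /=; last by rewrite add0n => h; right.
    by rewrite add1n => -[h]; left.
  by move=> [[[Ei h] ho]|[[h ho] nEi]]; split => //; case: asboolP => //;
    rewrite ho.
rewrite measureU//=.
- rewrite IH// cylC -EFinD; congr EFin; rewrite /= exprS; ring.
- exact: measurable_cylinder.
- by apply: measurableI; [exact: measurable_cylinder|exact: measurableC].
- by apply/seteqP; split => // w; rewrite /cylinder capU => -[[[]] ? _ _ [_]].
Qed.

Lemma occurrences_law L m : uniq L ->
  P [set w | occurrences L w = m] = (binom_law r (size L) m)%:E.
Proof.
move=> uL; have := @cylinder_law [::] L m uL; rewrite /= mul1r => <-.
by congr (P _); rewrite /cylinder; apply/seteqP; split => w //= [].
Qed.

Lemma occurrences_prob : 0 <= r <= 1.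
Proof.
have := @indepE [:: 0%N] isT; rewrite /= expr1 => h.
by rewrite -!lee_fin -h measure_ge0 probability_le1//;
  exact: fin_bigcap_measurable.
Qed.

Lemma measurable_deviation L eta :
  measurable [set w | eta <= `|(occurrences L w)%:R - (size L)%:R * r|].
Proof.
rewrite (_ : [set _ | _] = \bigcup_m ([set w | occurrences L w = m] `&`
  [set w | eta <= `|m%:R - (size L)%:R * r|])).
  apply: bigcup_measurable => m _; apply: measurableI.
    exact: measurable_occurrences.
  case: (boolP (eta <= `|m%:R - (size L)%:R * r|)) => h.
    by rewrite (_ : [set _ | _] = setT)//; apply/seteqP; split.
  by rewrite (_ : [set _ | _] = set0)//; apply/seteqP; split => // w.
apply/seteqP; split => w /=; first by move=> h; exists (occurrences L w).
by move=> [m _ [/= <-]].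
Qed.

(** Markov's inequality for the fourth power, summed over the finitely many
    values of the count. *)
Lemma deviation_le n (eta : R) : 0 < eta ->
  (P [set w | (eta <= `|(occurrences (iota 0 n) w)%:R - n%:R * r|)%R] <=
   ((3 * (n%:R * r) ^+ 2 + n%:R * r) / eta ^+ 4)%:E)%E.
Proof.
move=> eta0; set L := iota 0 n.
pose F (m : nat) := if eta <= `|m%:R - n%:R * r| then
  [set w | occurrences L w = m] else set0.
have mF m : measurable (F m).
  by rewrite /F; case: ifP => // _; exact: measurable_occurrences.
have sL : size L = n by rewrite size_iota.
apply: (@le_trans _ _ (P (\big[setU/set0]_(m < n.+1) F m))).
  apply: le_measure; rewrite ?inE.
  - by have := measurable_deviation L eta; rewrite sL.
  - exact: bigsetU_measurable.
  move=> w /= hw; rewrite -bigcup_mkord /F/=; exists (occurrences L w).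
    by rewrite /= ltnS -[leqRHS]sL count_size.
  by rewrite hw.
apply: le_trans; first by apply: Boole_inequality => m _; exact: mF.
apply: (@le_trans _ _ (\sum_(m < n.+1)
   (binom_law r n m * (m%:R - n%:R * r) ^+ 4 / eta ^+ 4)%:E)%E).
  apply: lee_sum => m _; rewrite /F; case: ifPn => h; last first.
    rewrite measure0 lee_fin divr_ge0 ?exprn_ge0 ?(ltW eta0)//.
    by rewrite mulr_ge0 ?exprn_even_ge0 ?binom_law_ge0 ?occurrences_prob.
  apply: (@le_trans _ _ (binom_law r n m)%:E).
    by rewrite -[n in binom_law r n m]sL -(occurrences_law m (iota_uniq 0 n)).
  rewrite lee_fin -mulrA ler_peMr//.
    by rewrite binom_law_ge0 ?occurrences_prob.
  rewrite ler_pdivlMr ?exprn_gt0// mul1r.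
  rewrite -[leRHS]ger0_norm ?exprn_even_ge0// normrX.
  by rewrite lerXn2r ?nnegrE// ltW.
rewrite sumEFin lee_fin -mulr_suml ler_wpM2r//.
  by rewrite invr_ge0 exprn_ge0// ltW.
by rewrite binom_law_moment4_le// occurrences_prob.
Qed.

End Deviation.

(** * Almost sure statements from summable probabilities *)
Section BorelCantelli.
Context d (T : measurableType d) (R : realType) (P : probability T R).

Lemma ae_eventually_notin_telescope (A : nat -> set T) (u : nat -> R) :
  (forall n, measurable (A n)) -> (forall n, 0 <= u n) ->
  (\forall n \near \oo, (P (A n) <= (u n - u n.+1)%:E)%E) ->
  {ae P, forall w, \forall n \near \oo, ~ A n w}.
Proof.
move=> mA u0 [n0 _ PA]; pose F n := A (n + n0)%N.
have mF n : measurable (F n) by exact: mA.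
have F0 : P (lim_sup_set F) = 0%E.
  apply: lim_sup_set_cvg0 => //; apply: (@le_lt_trans _ _ (u n0)%:E);
    last exact: ltry.
  apply: lime_le; first by apply: is_cvg_nneseries => n _ _.
  apply: nearW => n; apply: (@le_trans _ _ (u n0 - u (n + n0)%N)%:E); last first.
    by rewrite lee_fin gerBl.
  rewrite big_mkord; elim: n => [|n IH]; first by rewrite big_ord0 add0n subrr.
  rewrite big_ord_recr/=.
  apply: le_trans (leeD IH (PA (n + n0)%N _)) _; first by rewrite /= leq_addl.
  by rewrite -EFinD lee_fin addSn; lra.
have : P.-negligible (lim_sup_set F).
  apply/negligibleP => //; apply: bigcap_measurable => //.
  by move=> k _; apply: bigcup_measurable.
apply: negligibleS => w /= nw; rewrite /lim_sup_set => k _.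
apply: contrapT => h; apply: nw; exists (k + n0)%N => // n /= kn An; apply: h.
by exists (n - n0)%N; rewrite /F/= ?subnK//;
  [rewrite leq_subRL 1?addnC//; exact: leq_trans (leq_addl _ _) kn|
   exact: leq_trans (leq_addl _ _) kn].
Qed.

(** The series of n^-(1 + tau) converges because its terms are dominated by
    differences of n^-tau / tau; this is the inequality
    (n / (n - 1))^tau >= 1 + tau / n, from 1 + x <= e^x and
    ln (1 - 1/n) <= - 1/n. *)
Lemma power_telescope (tau : R) n : 0 < tau -> (1 < n)%N ->
  n%:R `^ (- (1 + tau)) <=
  tau^-1 * n.-1%:R `^ (- tau) - tau^-1 * n%:R `^ (- tau).
Proof.
move=> tau0 n1; rewrite -mulrBr mulrC ler_pdivlMr//.
have n0 : 0 < n%:R :> R by rewrite ltr0n ltnW.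
have m0 : 0 < n.-1%:R :> R by rewrite ltr0n -ltnS prednK// ltnW.
have nE : n%:R = n.-1%:R + 1 :> R by rewrite natr1 prednK// ltnW.
rewrite opprD powRD; last by rewrite (gt_eqF n0) implybT.
rewrite powR_inv1 ?(ltW n0)// lerBrDr.
have -> : n%:R^-1 * n%:R `^ (- tau) * tau + n%:R `^ (- tau) =
  n%:R `^ (- tau) * (1 + tau / n%:R) by ring.
have -> : n.-1%:R `^ (- tau) = n%:R `^ (- tau) * (n%:R / n.-1%:R) `^ tau :> R.
  rewrite powRM ?invr_ge0 ?(ltW n0) ?(ltW m0)// mulrA -powRD; last first.
    by rewrite (gt_eqF n0) implybT.
  rewrite addNr.
  by rewrite powRr0 mul1r -[in RHS]powR_inv1 ?(ltW m0)// -powRrM mulN1r.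
rewrite ler_wpM2l ?powR_ge0//.
have mn0 : 0 < n.-1%:R / n%:R :> R by rewrite divr_gt0.
rewrite -[n%:R / _]invrK invf_div /powR gt_eqF ?invr_gt0// lnV ?posrE//.
apply: le_trans (expR_ge1Dx _); rewrite lerD2l ler_wpM2l ?(ltW tau0)//.
have -> : n.-1%:R / n%:R = 1 + - n%:R^-1 :> R.
  rewrite (_ : n.-1%:R = n%:R - 1 :> R); last by rewrite nE addrK.
  by field; rewrite lt0r_neq0.
rewrite lerNr; apply: le_ln1Dx; rewrite ltrN2 invf_lt1 ?ltr1n//.
Qed.

Lemma ae_eventually_notin (A : nat -> set T) (C s : R) :
  (forall n, measurable (A n)) -> 0 <= C -> 1 < s ->
  (\forall n \near \oo, (P (A n) <= (C * n%:R `^ (- s))%:E)%E) ->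
  {ae P, forall w, \forall n \near \oo, ~ A n w}.
Proof.
move=> mA C0 s1 PA; pose tau := s - 1.
have tau0 : 0 < tau by rewrite subr_gt0.
apply: (@ae_eventually_notin_telescope _
  (fun n => C * (tau^-1 * n.-1%:R `^ (- tau)))) => //.
  by move=> n; rewrite !mulr_ge0 ?invr_ge0 ?powR_ge0 ?(ltW tau0).
near=> n; have n1 : (1 < n)%N by near: n; exists 2%N.
apply: (@le_trans _ _ (C * n%:R `^ (- s))%:E); first by near: n.
rewrite lee_fin -mulrBr ler_wpM2l//=.
by have := power_telescope tau0 n1; rewrite /tau addrC subrK.
Unshelve. all: by end_near. Qed.

End BorelCantelli.

(** * Regularly varying tails *)
Section RegularVariation.
Context (R : realType).

(** Regular variation with index - alpha at infinity, for positive
    nonincreasing functions. *)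
Definition regularly_varying (F : R -> R) (alpha : R) : Prop :=
  [/\ forall x y, x <= y -> F y <= F x, forall x, 0 < F x &
      forall lambda, 0 < lambda ->
        F (lambda * x) / F x @[x --> +oo] --> lambda `^ (- alpha)].

Lemma regularly_varyingM F G alpha beta :
  regularly_varying F alpha -> regularly_varying G beta ->
  regularly_varying (F \* G) (alpha + beta).
Proof.
move=> [Fd F0 Flim] [Gd G0 Glim]; split => /=.
- by move=> x y xy; rewrite ler_pM ?Fd ?Gd ?(ltW (F0 _)) ?(ltW (G0 _)).
- by move=> x; rewrite mulr_gt0.
move=> lambda l0; rewrite opprD powRD; last by rewrite (gt_eqF l0) implybT.
apply: cvg_trans (cvgM (Flim _ l0) (Glim _ l0)).
by apply: near_eq_cvg; apply: nearW => x /=; rewrite invfM mulrACA.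
Qed.

(** A one-step comparison valid beyond some point iterates, since the later
    points of a geometric progression stay beyond it; hence the bound is
    uniform in k. *)
Lemma regularly_varying_geometric F alpha (h w : R) :
  regularly_varying F alpha -> 0 < h -> expR (- (alpha * h)) < w ->
  \forall x \near +oo, forall k, F (x * expR (k%:R * h)) <= w ^+ k * F x.
Proof.
move=> [Fd F0 Flim] h0 hw.
have := Flim _ (expR_gt0 h).
rewrite -expRM mulrN mulrC => /cvgr_lt /(_ _ hw).
move=> [M [Mr HM]]; exists (Num.max M 0); split.
  by rewrite max_real// ?real0.
move=> x; rewrite gt_max => /andP[Mx x0].
elim=> [|k IH]; first by rewrite mul0r expR0 mulr1 expr0 mul1r.
have xk : M < x * expR (k%:R * h).
  rewrite (lt_le_trans Mx)// ler_peMr ?(ltW x0)//.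
  by rewrite -expR0 ler_expR mulr_ge0// ltW.
rewrite -natr1 mulrDl mul1r expRD mulrA mulrC.
have := HM _ xk => /=; rewrite ltr_pdivrMr// => /ltW /le_trans; apply.
rewrite exprS -mulrA ler_wpM2l// (le_trans _ (ltW hw))// ltW// expR_gt0//.
Qed.

(** Iterating F (e x) >= e^-alpha' F x along x0, e x0, e^2 x0 and so on gives
    the power bound at those points, and monotonicity extends it between
    them at the cost of the constant e^-alpha'. *)
Lemma regularly_varying_lower F alpha alpha' :
  regularly_varying F alpha -> 0 < alpha -> alpha < alpha' ->
  exists2 C, 0 < C & \forall x \near +oo, C * x `^ (- alpha') <= F x.
Proof.
move=> [Fd F0 Flim] a0 aa'; have h1 := expR_gt0 (1 : R).
have := Flim _ h1; rewrite -expRM mul1r.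
have : expR (- alpha') < expR (- alpha) by rewrite ltr_expR ltrN2.
move=> hw /cvgr_gt /(_ _ hw) [M [Mr HM]].
pose x0 := Num.max M 0 + 1.
have x0M : M < x0 by rewrite (@le_lt_trans _ _ (Num.max M 0)) ?le_max ?lexx//
  ltrDl.
have x00 : 0 < x0.
  by rewrite (@le_lt_trans _ _ (Num.max M 0)) ?le_max ?lexx ?orbT// ltrDl.
have step k : expR (- (k%:R * alpha')) * F x0 <= F (x0 * expR k%:R).
  elim: k => [|k IH]; first by rewrite mul0r oppr0 expR0 mul1r mulr1.
  have xk : M < x0 * expR k%:R.
    rewrite (lt_le_trans x0M)// ler_peMr ?(ltW x00)//.
    by rewrite -expR0 ler_expR.
  rewrite -natr1 expRD mulrA [_ * expR 1]mulrC.
  have := HM _ xk => /=; rewrite ltr_pdivlMr// => /ltW; apply: le_trans.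
  rewrite mulrDl mul1r opprD expRD [X in X * F x0]mulrC -mulrA.
  by rewrite ler_wpM2l// ltW// expR_gt0.
exists (expR (- alpha') * x0 `^ alpha' * F x0).
  by rewrite !mulr_gt0 ?expR_gt0 ?powR_gt0.
exists x0; split; first exact: num_real.
move=> x x0x; have xp : 0 < x := lt_trans x00 x0x.
pose y := ln (x / x0); have y0 : 0 <= y.
  by rewrite ln_ge0// ler_pdivlMr// mul1r ltW.
have xE : x = x0 * expR y by rewrite lnK ?posrE ?divr_gt0// mulrC divfK ?gt_eqF.
pose k := (Num.truncn y).+1.
have yk : y <= k%:R by rewrite ltW// truncnS_gt.
have ky : k%:R <= y + 1 by rewrite -natr1 lerD2r truncn_le.
apply: (le_trans _ (Fd x (x0 * expR k%:R) _)); last first.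
  by rewrite {1}xE ler_pM2l// ler_expR.
apply: le_trans (step k).
rewrite mulrAC ler_wpM2r ?(ltW (F0 _))// xE powRM ?(ltW x00) ?(ltW (expR_gt0
  _))//.
rewrite -!mulrA [_ `^ alpha' * _]mulrA -powRD; last first.
  by rewrite (gt_eqF x00) implybT.
rewrite addrN powRr0 mul1r -expRM -expRD ler_expR.
have := aa'; nra.
Qed.

End RegularVariation.

(** * Survival functions *)
Section Survival.
Context d (T : measurableType d) (R : realType) (P : probability T R).

(** The observations count with weak inequalities Z >= x, whereas the tail
    assumption is on P(K > x). *)
Definition survival (K : {RV P >-> R}) (x : R) : R :=
  fine (distribution P K `[x, +oo[).

Lemma survivalE (K : {RV P >-> R}) x :
  distribution P K `[x, +oo[ = (survival K x)%:E.
Proof. by rewrite fineK// fin_num_measure. Qed.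

Lemma survival_ge0 (K : {RV P >-> R}) x : 0 <= survival K x.
Proof. by rewrite fine_ge0. Qed.

Lemma survival_nonincreasing (K : {RV P >-> R}) x y :
  x <= y -> survival K y <= survival K x.
Proof.
move=> xy; rewrite -lee_fin -!survivalE le_measure ?inE//.
by apply: subset_itvr; rewrite bnd_simp.
Qed.

(** Continuity of L at x excludes an atom there: P(K >= x) <= P(K > y) for
    every y < x, and the right-hand side tends to the claimed value. *)
Lemma survival_tail (K : {RV P >-> R}) (a alpha : R) (L : R -> R) x :
  0 < a -> regular_tail K a alpha L -> derivable L x 1 -> a < x ->
  survival K x = L x * x `^ (- alpha).
Proof.
move=> a0 [alpha0 _ tailK] dL ax; have x0 := lt_trans a0 ax.
apply/eqP; rewrite eq_le; apply/andP; split; last first.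
  rewrite -lee_fin -survivalE -tailK ?(ltW ax)// /ccdf le_measure ?inE//.
  by apply: subset_itvr; rewrite bnd_simp.
rewrite leNgt; apply/negP => lt_surv.
have cL : {for x, continuous L}.
  by apply: differentiable_continuous; apply/derivable1_diffP.
have cp : {for x, continuous (@powR R ^~ (- alpha))}.
  apply: differentiable_continuous; apply/derivable1_diffP.
  by apply: derivable_powR; rewrite in_itv/= x0.
have lim : L y * y `^ (- alpha) @[y --> x^'-] --> L x * x `^ (- alpha).
  exact: cvg_at_left_filter (cvgM cL cp).
move/cvgr_lt : lim => /(_ _ lt_surv) near_lt.
have [y] : exists y, [/\ L y * y `^ (- alpha) < survival K x, a < y & y < x].
  apply: (@filter_ex _ x^'-); near=> y; split; near: y.
  - exact: near_lt.
  - exact: nbhs_left_gt.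
  - exact: nbhs_left_lt.
move=> [+ ay yx]; apply/negP; rewrite -leNgt.
rewrite -lee_fin -survivalE -tailK ?(ltW ay)// /ccdf le_measure ?inE//.
by apply: subset_itvr; rewrite bnd_simp.
Unshelve. all: by end_near. Qed.

Lemma survival_regularly_varying (K : {RV P >-> R}) (a alpha : R) (L : R -> R) :
  0 < a -> regular_tail K a alpha L -> (forall x, a < x -> derivable L x 1) ->
  regularly_varying (survival K) alpha.
Proof.
move=> a0 rK dL; have [alpha0 [_ L0 Llim] _] := rK.
have sE x (ax : a < x) := survival_tail a0 rK (dL _ ax) ax.
split.
- exact: survival_nonincreasing.
- move=> x; pose y := Num.max x (a + 1).
  have ay : a < y by rewrite lt_max ltrDl ltr01 orbT.
  apply: (@lt_le_trans _ _ (survival K y)).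
    by rewrite sE// mulr_gt0 ?L0 ?(ltW ay)// powR_gt0// (lt_trans a0).
  by apply: survival_nonincreasing; rewrite le_max lexx.
move=> lambda l0.
have lim : L (lambda * x) / L x * lambda `^ (- alpha) @[x --> +oo] -->
    1 * lambda `^ (- alpha).
  by apply: cvgM; [exact: Llim|exact: cvg_cst].
rewrite mul1r in lim; apply: cvg_trans lim; apply: near_eq_cvg; near=> x => /=.
have ax : a < x by near: x; apply: nbhs_pinfty_gt; exact: num_real.
have x0 := lt_trans a0 ax.
have alx : a < lambda * x.
  by rewrite mulrC -ltr_pdivrMr//; near: x; apply: nbhs_pinfty_gt;
    exact: num_real.
rewrite !sE// powRM ?(ltW l0) ?(ltW x0)//.
have := lt0r_neq0 (L0 _ (ltW ax)); have := lt0r_neq0 (powR_gt0 (- alpha) x0).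
by move=> ? ?; field; apply/andP.
Unshelve. all: by end_near. Qed.

End Survival.

(** * Law of large numbers for quadrant counts *)
Definition quadrant_count (R : realType) (x y : nat -> R) (n : nat) (s t : R) :
  R :=
  \sum_(i < n) ((s <= x i) && (t <= y i))%:R.

Lemma sum_geometric_le (R : realType) (w : R) n : 0 <= w < 1 ->
  \sum_(k < n) w ^+ k <= (1 - w)^-1.
Proof.
move=> /andP[w0 w1]; rewrite -[leRHS]mul1r ler_pdivlMr ?subr_gt0//.
have := subrX1 w n; have : 0 <= w ^+ n by rewrite exprn_ge0.
by set S := \sum_(k < n) _; nra.
Qed.

Section Counting.
Context d (T : measurableType d) (R : realType) (P : probability T R).
Variables X Y : nat -> {RV P >-> R}.
Hypothesis idX : identically_distributed X.
Hypothesis idY : identically_distributed Y.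
Hypothesis indXY : mutually_independent (joint_family X Y).

Definition quadrant (s t : R) (i : nat) : set T :=
  (X i @^-1` `[s, +oo[) `&` (Y i @^-1` `[t, +oo[).

Local Notation count n s t w := (quadrant_count (X^~ w) (Y^~ w) n s t).
Local Notation surv2 s t := (survival (X 0%N) s * survival (Y 0%N) t).

Lemma measurable_quadrant s t i : measurable (quadrant s t i).
Proof.
apply: measurableI.
  by rewrite -[_ @^-1` _]setTI; exact: measurable_funPT.
by rewrite -[_ @^-1` _]setTI; exact: measurable_funPT.
Qed.

Lemma quadrant_independent s t (J : seq nat) : uniq J ->
  P (\bigcap_(j in [set` J]) quadrant s t j) = ((surv2 s t) ^+ size J)%:E.
Proof.
move=> uJ.
pose A (k : nat + nat) : set R :=
  match k with inl _ => [set` `[s, +oo[] | inr _ => [set` `[t, +oo[] end.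
pose JJ := map (@inl nat nat) J ++ map (@inr nat nat) J.
have uJJ : uniq JJ.
  rewrite cat_uniq !map_inj_uniq ?uJ ?andbT/=; [|by move=> ? ? []..].
  by apply/hasPn => k /mapP[j _ ->]; apply/mapP => -[].
have mA k : measurable (A k) by case: k => j; exact: measurable_itv.
have := indXY uJJ mA; rewrite /JJ big_cat !big_map/=.
have -> : (\prod_(j <- J) P (X j @^-1` `[s, +oo[))%E = (survival (X 0%N) s ^+
  size J)%:E.
  elim: (J) => [|j K IH]; first by rewrite big_nil.
  rewrite big_cons IH (_ : P _ = (survival (X 0%N) s)%:E).
    by rewrite -EFinM exprS.
  by rewrite -survivalE; exact: idX.
have -> : (\prod_(j <- J) P (Y j @^-1` `[t, +oo[))%E = (survival (Y 0%N) t ^+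
  size J)%:E.
  elim: (J) => [|j K IH]; first by rewrite big_nil.
  rewrite big_cons IH (_ : P _ = (survival (Y 0%N) t)%:E).
    by rewrite -EFinM exprS.
  by rewrite -survivalE; exact: idY.
rewrite -EFinM -exprMn => <-; congr (P _).
apply/seteqP; split => w h.
  move=> k /=; rewrite mem_cat => /orP[] /mapP[j jJ ->]; by have [] := h j jJ.
move=> j /= jJ; split.
  by apply: (h (inl j)); rewrite /= mem_cat map_f.
by apply: (h (inr j)); rewrite /= mem_cat (map_f (@inr nat nat)) ?orbT.
Qed.

Lemma quadrant_countE n s t w :
  count n s t w = (occurrences (quadrant s t) (iota 0 n) w)%:R.
Proof.
rewrite /quadrant_count /occurrences -sum1_count natr_sum.
rewrite -(big_mkord xpredT (fun i => ((s <= X i w) && (t <= Y i w))%:R)).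
rewrite [RHS]big_mkcond/= /index_iota subn0; apply: eq_bigr => i _.
rewrite (_ : `[< _ >] = (s <= X i w) && (t <= Y i w)).
  by case: ifP => // ->.
by apply/asboolP/idP; rewrite /quadrant/= !in_itv/= !andbT => /andP.
Qed.

Lemma measurable_count_deviation n s t (c eta : R) :
  measurable [set w | eta <= `|count n s t w - n%:R * c|].
Proof.
rewrite (_ : [set _ | _] = [set w | eta <=
    `|(occurrences (quadrant s t) (iota 0 n) w)%:R - (size (iota 0 n))%:R * c|]).
  exact: measurable_deviation (measurable_quadrant s t) _ _.
by apply/seteqP; split => w /=; rewrite quadrant_countE size_iota.
Qed.

(** The deviation is measured against n p rather than n r, where r <= rho p
    is the probability of the quadrant. Remote quadrants have a small rho, and
    the factor rho is what makes a union bound over them possible. *)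
Lemma count_deviation_le n s t (p rho eps : R) :
  0 < eps -> 1 <= n%:R * p -> surv2 s t <= rho * p -> 0 <= rho <= 1 ->
  (P [set w | eps * (n%:R * p) <= `|count n s t w - n%:R * surv2 s t|]%R <=
   (4 * rho / eps ^+ 4 / (n%:R * p) ^+ 2)%:E)%E.
Proof.
move=> e0 np1 rp /andP[rho0 rho1]; have np0 : 0 < n%:R * p by rewrite
  (lt_le_trans _ np1).
have r0 : 0 <= surv2 s t by rewrite mulr_ge0 ?survival_ge0.
rewrite (_ : [set _ | _] = [set w | eps * (n%:R * p) <=
    `|(occurrences (quadrant s t) (iota 0 n) w)%:R - n%:R * surv2 s t|]);
      last first.
  by apply/seteqP; split => w /=; rewrite quadrant_countE.
apply: le_trans.
  apply: (deviation_le (measurable_quadrant s t) (@quadrant_independent s t)).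
  by rewrite mulr_gt0.
rewrite lee_fin ler_pdivrMr ?exprn_gt0 ?(mulr_gt0 e0 np0)//.
have -> : 4 * rho / eps ^+ 4 / (n%:R * p) ^+ 2 * (eps * (n%:R * p)) ^+ 4 =
   4 * rho * (n%:R * p) ^+ 2.
  have := lt0r_neq0 e0; have := lt0r_neq0 np0.
  move: (n%:R * p) => q q0 ee0; field; exact/andP.
have nr : n%:R * surv2 s t <= rho * (n%:R * p) by rewrite [leRHS]mulrCA ler_wpM2l.
have nr0 : 0 <= n%:R * surv2 s t by rewrite mulr_ge0.
move: (n%:R * surv2 s t) (n%:R * p) nr nr0 np1 np0 => u v uv u0 v1 v0.
have h1 : u ^+ 2 <= rho * v ^+ 2.
  apply: (@le_trans _ _ ((rho * v) ^+ 2));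
    first by rewrite lerXn2r ?nnegrE// mulr_ge0// ltW.
  by rewrite exprMn ler_wpM2r ?sqr_ge0// expr2 ler_piMr.
have h2 : u <= rho * v ^+ 2.
  by rewrite (le_trans uv)// ler_wpM2l// expr2 ler_peMr// ltW.
by rewrite -mulrA; lra.
Qed.

Variables (t : nat -> R) (sigma : R).
Local Notation p n := (surv2 (t n) (t n)).
Hypothesis sigma_gt : 1 / 2 < sigma.
Hypothesis many : \forall n \near \oo, n%:R `^ sigma <= n%:R * p n.

(** The second left-hand side bounds a deviation at one threshold, up to a
    constant; 2 sigma > 1 makes the right-hand side summable. *)
Lemma many_sqr_inv : \forall n \near \oo,
  1 <= n%:R * p n /\ ((n%:R * p n) ^+ 2)^-1 <= n%:R `^ (- (2 * sigma)).
Proof.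
near=> n; have n0 : (0 < n)%N by near: n; exists 1%N.
have sn : n%:R `^ sigma <= n%:R * p n by near: n.
have s1 : 1 <= n%:R `^ sigma.
  rewrite -[leLHS](powRr0 n%:R) ler_powR ?ler1n//.
  by apply: ltW; apply: lt_trans sigma_gt; lra.
split; first exact: le_trans sn.
rewrite powRN lef_pV2 ?posrE ?exprn_gt0 ?powR_gt0 ?ltr0n//; last first.
  by rewrite (lt_le_trans _ sn)// powR_gt0 ?ltr0n.
rewrite [2 * sigma]mulrC powRrM powR_mulrn ?powR_ge0//.
by rewrite lerXn2r ?nnegrE ?powR_ge0// (le_trans _ sn) ?powR_ge0.
Unshelve. all: by end_near. Qed.

Lemma count_lln (s s' : nat -> R) (eps : R) : 0 < eps ->
  (\forall n \near \oo, t n <= s n /\ t n <= s' n) ->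
  {ae P, forall w, \forall n \near \oo,
    `|count n (s n) (s' n) w - n%:R * surv2 (s n) (s' n)| < eps * (n%:R * p n)}.
Proof.
move=> e0 ts.
pose A n := [set w | eps * (n%:R * p n) <=
  `|count n (s n) (s' n) w - n%:R * surv2 (s n) (s' n)|].
have : {ae P, forall w, \forall n \near \oo, ~ A n w}.
  apply: (@ae_eventually_notin _ _ _ _ A (4 / eps ^+ 4) (2 * sigma)).
  - by move=> n; exact: measurable_count_deviation.
  - by rewrite divr_ge0// exprn_ge0// ltW.
  - by have := sigma_gt; lra.
  near=> n.
  have [np1 npV] : 1 <= n%:R * p n /\ ((n%:R * p n) ^+ 2)^-1 <= n%:R `^ (- (2 *
    sigma)).
    by near: n; exact: many_sqr_inv.
  have [tsn tsn'] : t n <= s n /\ t n <= s' n by near: n.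
  apply: le_trans (@count_deviation_le n (s n) (s' n) (p n) 1 eps e0 np1 _ _) _.
  - by rewrite mul1r ler_pM ?survival_ge0 ?survival_nonincreasing.
  - by rewrite ler01 lexx.
  by rewrite mulr1 lee_fin ler_wpM2l// divr_ge0// exprn_ge0// ltW.
apply: filterS => w; apply: filterS => n /negP; rewrite /A/=.
by rewrite -ltNge.
Unshelve. all: by end_near. Qed.

(** Level k of the grid has probability at most w0^(5k) p and is granted a
    deviation w0^k n p: by the fourth moment it exceeds it with probability
    O(w0^(5k) / w0^(4k)) = O(w0^k), which is summable in k. *)
Lemma count_decay (h w0 : R) : 0 < w0 < 1 ->
  (\forall n \near \oo, forall k,
    surv2 (t n * expR (k%:R * h)) (t n * expR (k%:R * h)) <= (w0 ^+ 5) ^+ k * p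
      n) ->
  {ae P, forall w, \forall n \near \oo, forall k,
    count n (t n * expR (k%:R * h)) (t n * expR (k%:R * h)) w
    <= 2 * w0 ^+ k * (n%:R * p n)}.
Proof.
move=> /andP[w00 w01] dec.
pose z n k := t n * expR (k%:R * h).
pose A n k := [set w | w0 ^+ k * (n%:R * p n) <=
  `|count n (z n k) (z n k) w - n%:R * surv2 (z n k) (z n k)|].
have mA n k : measurable (A n k) by exact: measurable_count_deviation.
have : {ae P, forall w, \forall n \near \oo, ~ (\bigcup_k A n k) w}.
  apply: (@ae_eventually_notin _ _ _ _ _ (4 * (1 - w0)^-1) (2 * sigma)).
  - by move=> n; apply: bigcup_measurable.
  - by rewrite mulr_ge0// invr_ge0 subr_ge0 ltW.
  - by have := sigma_gt; lra.
  near=> n.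
  have [np1 npV] : 1 <= n%:R * p n /\ ((n%:R * p n) ^+ 2)^-1 <= n%:R `^ (- (2 *
    sigma)).
    by near: n; exact: many_sqr_inv.
  have decn : forall k, surv2 (z n k) (z n k) <= (w0 ^+ 5) ^+ k * p n by near: n.
  apply: (@le_trans _ _ (\sum_(k <oo) P (A n k))%E).
    by apply: measure_sigma_subadditive => //; apply: bigcup_measurable.
  apply: lime_le; first by apply: is_cvg_nneseries => k _ _.
  apply: nearW => N; rewrite big_mkord.
  apply: (@le_trans _ _ (\sum_(k < N) (4 * w0 ^+ k * ((n%:R * p n) ^+
    2)^-1)%:E)%E).
    apply: lee_sum => k _.
    apply: le_trans (@count_deviation_le n (z n k) (z n k) (p n) ((w0 ^+ 5) ^+ k)
      (w0 ^+ k) _ np1 (decn k) _) _.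
    - by rewrite exprn_gt0.
    - by rewrite !exprn_ge0 ?(ltW w00)// !exprn_ile1 ?exprn_ge0 ?(ltW w00)
      ?(ltW w01).
    rewrite lee_fin ler_wpM2r ?invr_ge0 ?sqr_ge0//.
    rewrite -mulrA ler_wpM2l// ler_pdivrMr ?exprn_gt0//.
    by rewrite -!exprM -exprD -mulnS mulnC.
  rewrite sumEFin lee_fin -mulr_suml -mulr_sumr.
  rewrite ler_pM ?invr_ge0 ?sqr_ge0 ?mulr_ge0 ?sumr_ge0//.
    by move=> k _; rewrite exprn_ge0// ltW.
  by rewrite ler_wpM2l// sum_geometric_le// (ltW w00).
have nearp : \forall n \near \oo, forall k,
   surv2 (z n k) (z n k) <= (w0 ^+ 5) ^+ k * p n by exact: dec.
apply: filterS => w nA; near=> n => k.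
have decn : surv2 (z n k) (z n k) <= (w0 ^+ 5) ^+ k * p n.
  by move: k; near: n; exact: nearp.
have : ~ (\bigcup_k A n k) w by near: n.
move=> nAn; have : ~ A n k w by move=> Ank; apply: nAn; exists k.
move=> /negP; rewrite /A/= -ltNge => /(le_lt_trans (ler_norm _)).
rewrite ltrBlDr => /ltW /le_trans; apply.
rewrite -mulrA mulr2n mulrDl !mul1r lerD2l.
have pn0 : 0 <= p n by rewrite mulr_ge0 ?survival_ge0.
rewrite [leRHS]mulrCA ler_wpM2l// (le_trans decn)// ler_wpM2r// -exprM.
by rewrite ler_wiXn2l ?(ltW w00) ?(ltW w01)// leq_pmull.
Unshelve. all: by end_near. Qed.

End Counting.

(** * Comparison with a geometric grid *)
Section Grid.
Context (R : realType).
Implicit Types (x y : nat -> R) (s : nat -> R).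

Definition uncensored_count x y n (s : R) : R :=
  \sum_(i < n) (x i <= y i)%R%:R * (s <= Num.min (x i) (y i))%R%:R.

Definition log_excess (s z : R) : R := if s <= z then ln (z / s) else 0.

Definition log_excess_sum x y n (s : R) : R :=
  \sum_(i < n) log_excess s (Num.min (x i) (y i)).

(** For a point with X <= Y, having X above level k + 1 and Y above level k is
    the same as having both above k + 1, so the sum telescopes; a point with
    X > Y contributes nonnegative terms. *)
Lemma uncensored_count_le x y n s K : {homo s : i j / (i <= j)%N >-> i <= j} ->
  uncensored_count x y n (s 0%N) <=
  \sum_(k < K) (quadrant_count x y n (s k) (s k) -
                quadrant_count x y n (s k.+1) (s k)) +
  quadrant_count x y n (s K) (s K).
Proof.
move=> smono; rewrite /uncensored_count /quadrant_count.
under [X in _ <= X + _]eq_bigr => k _ do rewrite -sumrB.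
rewrite exchange_big -big_split/=; apply: ler_sum => i _.
rewrite le_min; case: (leP (x i) (y i)) => xy; rewrite ?mul1r ?mul0r; last first.
  rewrite addr_ge0// sumr_ge0// => k _; rewrite subr_ge0 ler_nat.
  have [h|] := leP (s k.+1) (x i) => //=.
  by rewrite (le_trans (smono k k.+1 (leqnSn k)) h).
elim: K => [|K IH]; first by rewrite big_ord0 add0r.
rewrite big_ord_recr/= (le_trans IH)// -!addrA lerD2l.
rewrite lerDl addrC subr_ge0 ler_nat.
have [h|] := leP (s K.+1) (x i) => //=.
by rewrite (le_trans h xy); case: (_ <= _).
Qed.

(** A point with X > Y and Y above level k + 1 also has X above level k + 1,
    so its terms vanish; for X <= Y the sum telescopes. *)
Lemma uncensored_count_ge x y n s K : {homo s : i j / (i <= j)%N >-> i <= j} ->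
  \sum_(k < K) (quadrant_count x y n (s k) (s k.+1) -
                quadrant_count x y n (s k.+1) (s k.+1)) <=
  uncensored_count x y n (s 0%N).
Proof.
move=> smono; rewrite /uncensored_count /quadrant_count.
under eq_bigr => k _ do rewrite -sumrB.
rewrite exchange_big; apply: ler_sum => i _ /=.
rewrite le_min; case: (leP (x i) (y i)) => xy; rewrite ?mul1r ?mul0r; last first.
  rewrite -oppr_ge0 -sumrN sumr_ge0// => k _; rewrite opprB subr_ge0 ler_nat.
  have [h|] := leP (s k.+1) (y i); last by rewrite andbF.
  by rewrite (le_trans h (ltW xy)) andbT; case: (_ <= _).
suff : \sum_(k < K) (((s k <= x i) && (s k.+1 <= y i))%:R -
    ((s k.+1 <= x i) && (s k.+1 <= y i))%:R) +
    ((s K <= x i) && (s K <= y i))%:R <=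
    ((s 0%N <= x i) && (s 0%N <= y i))%:R :> R.
  by apply: le_trans; rewrite lerDl.
elim: K => [|K IH]; first by rewrite big_ord0 add0r.
rewrite big_ord_recr/= (le_trans _ IH)// -!addrA lerD2l addNr addr0 ler_nat.
have [h|] := leP (s K) (x i) => //=.
by rewrite (le_trans h xy); case: (_ <= _).
Qed.

Section LogExcess.
Variables (s h : R).
Hypotheses (s0 : 0 < s) (h0 : 0 < h).
Let g k := s * expR (k%:R * h).

Let g0 : g 0 = s.
Proof. by rewrite /g mul0r expR0 mulr1. Qed.

Lemma geometric_grid_homo : {homo g : i j / (i <= j)%N >-> i <= j}.
Proof. by move=> i j ij; rewrite ler_pM2l// ler_expR ler_pM2r// ler_nat. Qed.

Lemma log_excess_le (z : R) K : z < g K ->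
  log_excess s z <= h * \sum_(k < K) (g k <= z)%R%:R.
Proof.
rewrite /log_excess; elim: K => [|K IH] zK.
  by rewrite g0 in zK; rewrite [s <= z]lt_geF// big_ord0 mulr0.
have [Kz|] := leP (g K) z; last first.
  move=> zK'; rewrite (le_trans (IH zK'))// ler_wpM2l ?(ltW h0)//.
  by rewrite big_ord_recr/= lerDl.
have gz k : (k <= K)%N -> g k <= z.
  by move=> kK; apply: le_trans Kz; exact: geometric_grid_homo.
have sz : s <= z by rewrite -g0 gz.
have z0 : 0 < z by apply: lt_le_trans sz.
rewrite sz (eq_bigr (fun=> 1)); last first.
  by move=> k _; rewrite gz//; have := ltn_ord k; rewrite ltnS.
rewrite sumr_const card_ord [leRHS]mulrC -ler_expR.
rewrite lnK ?posrE ?divr_gt0// ler_pdivrMr// [leRHS]mulrC.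
exact: ltW.
Qed.

Lemma log_excess_ge (z : R) K :
  h * \sum_(k < K) (g k.+1 <= z)%R%:R <= log_excess s z.
Proof.
have le0 : 0 <= log_excess s z.
  rewrite /log_excess; case: ifP => // sz.
  by rewrite ln_ge0// ler_pdivlMr// mul1r.
elim: K => [|K IH]; first by rewrite big_ord0 mulr0.
have [Kz|] := leP (g K.+1) z; last first.
  by move=> zK; rewrite big_ord_recr/= [g K.+1 <= z]lt_geF// addr0.
have gz k : (k <= K.+1)%N -> g k <= z.
  by move=> kK; apply: le_trans Kz; exact: geometric_grid_homo.
have sz : s <= z by rewrite -g0 gz.
have z0 : 0 < z by apply: lt_le_trans sz.
rewrite /log_excess sz (eq_bigr (fun=> 1)); last first.
  by move=> k _; rewrite gz.
rewrite sumr_const card_ord [leLHS]mulrC -ler_expR.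
rewrite lnK ?posrE ?divr_gt0// ler_pdivlMr// [leLHS]mulrC.
exact: gz.
Qed.

Lemma quadrant_count_diag x y n t :
  quadrant_count x y n t t = \sum_(i < n) (t <= Num.min (x i) (y i))%R%:R.
Proof. by apply: eq_bigr => i _; rewrite le_min. Qed.

Lemma log_excess_sum_ge x y n K :
  h * \sum_(k < K) quadrant_count x y n (g k.+1) (g k.+1) <=
  log_excess_sum x y n s.
Proof.
under eq_bigr => k _ do rewrite quadrant_count_diag.
by rewrite exchange_big mulr_sumr; apply: ler_sum => i _; exact: log_excess_ge.
Qed.

(** Finitely many levels suffice since the grid exceeds every sample point
    eventually; how many depends on the sample, so that taking limits in this
    bound needs a majorant that is uniform in the level. *)
Lemma log_excess_sum_le x y n : exists K0, forall K, (K0 <= K)%N ->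
  log_excess_sum x y n s <= h * \sum_(k < K) quadrant_count x y n (g k) (g k).
Proof.
have [K0 HK0] : exists K0, forall K, (K0 <= K)%N ->
    forall i, (i < n)%N -> Num.min (x i) (y i) < g K.
  elim: n => [|n [K0 IH]]; first by exists 0%N.
  pose z := Num.min (x n) (y n).
  exists (maxn K0 (Num.truncn (Num.max 0 (ln (z / s) / h))).+1) => K.
  rewrite geq_max => /andP[K0K zK] i; rewrite ltnS leq_eqVlt => /predU1P[->|];
    last first.
    by apply: IH.
  have [z0|z0] := leP z 0; first by rewrite (le_lt_trans z0)// mulr_gt0//
    expR_gt0.
  rewrite -/z /g mulrC -ltr_pdivrMr// -ltr_ln ?posrE ?divr_gt0 ?expR_gt0//.
  rewrite expRK -ltr_pdivrMr//.
  apply: (@le_lt_trans _ _ (Num.max 0 (ln (z / s) / h)));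
    first by rewrite le_max lexx orbT.
  by rewrite (lt_le_trans (truncnS_gt _))// ler_nat.
exists K0 => K K0K; under eq_bigr => k _ do rewrite quadrant_count_diag.
rewrite exchange_big mulr_sumr; apply: ler_sum => i _; apply: log_excess_le.
exact: HK0.
Qed.

End LogExcess.
End Grid.

(** * Limits of the normalised sums *)
Section Limits.
Context (R : realType).

(** Convergence by bounds that depend on e: the mesh and the number of levels
    are chosen after e, before n grows. *)
Lemma cvg_of_asymptotic_bounds (f : nat -> R) (l : R) :
  (forall e, 0 < e -> exists g u, [/\ \forall n \near \oo, f n <= g n,
     g @ \oo --> u & u < l + e]) ->
  (forall e, 0 < e -> exists g u, [/\ \forall n \near \oo, g n <= f n,
     g @ \oo --> u & l - e < u]) ->
  f @ \oo --> l.
Proof.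
move=> up lo; apply/cvgrPdist_lt => e e0.
have [g [u [fg gu ule]]] := up _ e0; have [g' [u' [fg' gu' ule']]] := lo _ e0.
have gl : \forall n \near \oo, g n < l + e by apply: cvgr_lt ule.
have gl' : \forall n \near \oo, l - e < g' n by apply: cvgr_gt ule'.
near=> n; rewrite distrC ltr_distl; apply/andP; split.
  apply: (@lt_le_trans _ _ (g' n)); first by near: n.
  by near: n.
apply: (@le_lt_trans _ _ (g n)); first by near: n.
by near: n.
Unshelve. all: by end_near. Qed.

(** Countably many grids suffice, so that the exceptional null sets of all
    grids have a null union. *)
Definition mesh (m : nat) : R := m.+1%:R^-1.

Lemma mesh_gt0 m : 0 < mesh m.
Proof. by rewrite invr_gt0. Qed.

Lemma fine_mesh_exists (alpha c e : R) : 0 < e ->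
  exists m, c * expR (alpha * mesh m) < c + e /\
    c - e < c * expR (- (alpha * mesh m)).
Proof.
move=> e0.
have lim b : c * expR (b * mesh m) @[m --> \oo] --> c.
  rewrite -[X in _ --> X]mulr1; apply: cvgM; first exact: cvg_cst.
  rewrite -expR0; apply: continuous_cvg; first exact: continuous_expR.
  rewrite -[X in _ --> X](mulr0 b); apply: cvgM; first exact: cvg_cst.
  exact: cvg_harmonic.
have ce : c < c + e by rewrite ltrDl.
have ce' : c - e < c by rewrite gtrBl.
have h1 : \forall m \near \oo, c * expR (alpha * mesh m) < c + e.
  by apply: cvgr_lt ce; exact: lim.
have h2 : \forall m \near \oo, c - e < c * expR ((- alpha) * mesh m).
  by apply: cvgr_gt ce'; exact: lim.
have [m [? ?]] : exists m, c * expR (alpha * mesh m) < c + e /\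
    c - e < c * expR ((- alpha) * mesh m).
  apply: (@filter_ex _ \oo); near=> m; split; near: m; [exact: h1|exact: h2].
by exists m; rewrite -mulNr.
Unshelve. all: by end_near. Qed.

Lemma pow_lt_exists (w c e : R) : 0 <= w < 1 -> 0 < e -> exists K, c * w ^+ K < e.
Proof.
move=> /andP[w0 w1] e0.
have lim : c * w ^+ K @[K --> \oo] --> 0.
  rewrite -[X in _ --> X](mulr0 c); apply: cvgM; first exact: cvg_cst.
  by apply: cvg_expr; rewrite ger0_norm.
have : \forall K \near \oo, c * w ^+ K < e by apply: cvgr_lt e0.
exact: filter_ex.
Qed.

Lemma onem_expRN_le (a : R) : 1 - expR (- a) <= a.
Proof. by rewrite lerBlDr -lerBlDl; exact: expR_ge1Dx. Qed.

Lemma onem_expRN_ge (a : R) : a * expR (- a) <= 1 - expR (- a).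
Proof.
rewrite -subr_ge0.
have -> : 1 - expR (- a) - a * expR (- a) = expR (- a) * (expR a - (1 + a)).
  by rewrite -[X in X - _ - _](expRxMexpNx_1 a); ring.
by rewrite mulr_ge0 ?(ltW (expR_gt0 _))// subr_ge0 expR_ge1Dx.
Qed.

Variables (x y t v : nat -> R) (aX aY : R).
Hypotheses (aX0 : 0 < aX) (aY0 : 0 < aY).
Hypothesis t0 : \forall n \near \oo, 0 < t n.
Hypothesis v0 : \forall n \near \oo, 0 < v n.
Let D := quadrant_count x y.
Let g m n k := t n * expR (k%:R * mesh m).
Hypothesis grid_limit : forall m j k,
  D n (g m n j) (g m n k) / v n @[n --> \oo] -->
    expR (- (aX * mesh m)) ^+ j * expR (- (aY * mesh m)) ^+ k.
(* A summable majorant for all levels at once, as in dominated convergence. *)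
Hypothesis grid_tail : forall m, exists2 w, 0 < w < 1 &
  \forall n \near \oo, forall k, D n (g m n k) (g m n k) <= 2 * w ^+ k * v n.

Let alpha := aX + aY.
Let alpha0 : 0 < alpha. Proof. exact: addr_gt0. Qed.
Let g0 m n : g m n 0 = t n. Proof. by rewrite /g mul0r expR0 mulr1. Qed.

Let a m := expR (- (aX * mesh m)).
Let b m := expR (- (aY * mesh m)).
Let r m := a m * b m.

Let rE m : r m = expR (- (alpha * mesh m)).
Proof. by rewrite /r /a /b -expRD mulrDl opprD. Qed.

Let r_gt0 m : 0 < r m. Proof. by rewrite rE expR_gt0. Qed.
Let r_lt1 m : r m < 1.
Proof. by rewrite rE -expR0 ltr_expR oppr_lt0 mulr_gt0// mesh_gt0. Qed.
Let rV m : (r m)^-1 = expR (alpha * mesh m).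
Proof. by rewrite rE expRN invrK. Qed.
Let onem_r_gt0 m : 0 < 1 - r m. Proof. by rewrite subr_gt0. Qed.

Let sum_r m K : \sum_(k < K) r m ^+ k = (1 - r m ^+ K) / (1 - r m).
Proof.
apply: (mulIf (lt0r_neq0 (onem_r_gt0 m))); rewrite divfK ?lt0r_neq0//.
by have := subrX1 (r m) K; set S := \sum_(k < K) _; lra.
Qed.

Lemma cvg_exceedance_count : D n (t n) (t n) / v n @[n --> \oo] --> (1 : R).
Proof.
have := @grid_limit 0 0 0; rewrite !expr0 mulr1; apply: cvg_trans.
by apply: near_eq_cvg; apply: nearW => n; rewrite !g0.
Qed.

(** With a = e^(-alphaX h) and r = e^(-alpha h), the grid bounds converge,
    up to r^K, to (1 - a) / (1 - r) and e^(-alphaY h) (1 - a) / (1 - r). By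
    x e^-x <= 1 - e^-x <= x these lie within factors r^-1 and r of
    alphaX / alpha, and r tends to 1 with the mesh. *)
Lemma cvg_uncensored_count :
  uncensored_count x y n (t n) / v n @[n --> \oo] --> aX / alpha.
Proof.
have ga n m : 0 < t n -> {homo g m n : i j / (i <= j)%N >-> i <= j}.
  by move=> tn; apply: geometric_grid_homo => //; exact: mesh_gt0.
have c0 : 0 < aX / alpha by rewrite divr_gt0.
apply: cvg_of_asymptotic_bounds => e e0; have e20 : 0 < e / 2 by rewrite divr_gt0.
  have [m [hm _]] := fine_mesh_exists alpha (aX / alpha) e20.
  have [K hK] : exists K, 1 * r m ^+ K < e / 2.
    by apply: pow_lt_exists => //; rewrite (ltW (r_gt0 m)) r_lt1.
  exists (fun n => \sum_(k < K) (D n (g m n k) (g m n k) / v n -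
     D n (g m n k.+1) (g m n k) / v n) + D n (g m n K) (g m n K) / v n).
  exists (\sum_(k < K) (a m ^+ k * b m ^+ k - a m ^+ k.+1 * b m ^+ k) +
     a m ^+ K * b m ^+ K); split.
  - near=> n; have tn : 0 < t n by near: n.
    have vn : 0 < v n by near: n.
    under eq_bigr => k _ do rewrite -mulrBl.
    rewrite -mulr_suml -mulrDl ler_pM2r ?invr_gt0// -[t n](g0 m).
    by apply: uncensored_count_le; exact: ga.
  - apply: cvgD; last exact: grid_limit.
    apply: cvg_big => [|k _]; first exact: add_continuous.
    by apply: cvgB; exact: grid_limit.
  rewrite -exprMn -/(r m).
  under eq_bigr => k _ do rewrite exprS -mulrA -exprMn -/(r m) -{1}[_ ^+
    k]mul1r -mulrBl.
  rewrite -mulr_sumr sum_r; rewrite mul1r in hK.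
  have -> : aX / alpha + e = aX / alpha + e / 2 + e / 2 by lra.
  rewrite ltrD// (le_lt_trans _ hm)// -rV.
  rewrite mulrA ler_pdivrMr// ; apply: (@le_trans _ _ (1 - a m)).
    rewrite ler_piMr ?subr_ge0//.
      by rewrite /a -expR0 ler_expR oppr_le0 mulr_ge0// ltW// mesh_gt0.
    by rewrite gerBl exprn_ge0// ltW.
  apply: (le_trans (onem_expRN_le _)).
  have := onem_expRN_ge (alpha * mesh m); rewrite -rE.
  move=> /(ler_wpM2l (ltW (divr_gt0 c0 (r_gt0 m)))); apply: le_trans.
  rewrite le_eqVlt; apply/orP; left; apply/eqP.
  by field; rewrite !lt0r_neq0.
have [m [_ hm]] := fine_mesh_exists alpha (aX / alpha) e20.
have [K hK] : exists K, aX / alpha * r m ^+ K < e / 2.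
  by apply: pow_lt_exists => //; rewrite (ltW (r_gt0 m)) r_lt1.
exists (fun n => \sum_(k < K) (D n (g m n k) (g m n k.+1) / v n -
   D n (g m n k.+1) (g m n k.+1) / v n)).
exists (\sum_(k < K) (a m ^+ k * b m ^+ k.+1 - a m ^+ k.+1 * b m ^+ k.+1)); split.
- near=> n; have tn : 0 < t n by near: n.
  have vn : 0 < v n by near: n.
  under eq_bigr => k _ do rewrite -mulrBl.
  rewrite -mulr_suml ler_pM2r ?invr_gt0// -[t n](g0 m).
  by apply: uncensored_count_ge; exact: ga.
- apply: cvg_big => [|k _]; first exact: add_continuous.
  by apply: cvgB; exact: grid_limit.
have -> : \sum_(k < K) (a m ^+ k * b m ^+ k.+1 - a m ^+ k.+1 * b m ^+ k.+1) =
    b m * (1 - a m) * \sum_(k < K) r m ^+ k.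
  rewrite mulr_sumr; apply: eq_bigr => k _.
  by rewrite !exprS /r exprMn; ring.
rewrite sum_r.
have key : aX / alpha * r m <= b m * (1 - a m) / (1 - r m).
  rewrite ler_pdivlMr// (@le_trans _ _ (aX / alpha * r m * (alpha * mesh m)))//.
    by rewrite (ler_wpM2l (ltW (mulr_gt0 c0 (r_gt0 m))))// rE onem_expRN_le.
  have -> : aX / alpha * r m * (alpha * mesh m) = b m * (aX * mesh m * a m).
    by rewrite /r; field; rewrite lt0r_neq0.
  by rewrite ler_wpM2l ?(ltW (expR_gt0 _))// onem_expRN_ge.
have rK1 : r m ^+ K <= 1 by rewrite exprn_ile1 ?(ltW (r_gt0 m)) ?(ltW (r_lt1 m)).
apply: (@lt_le_trans _ _ (aX / alpha * r m * (1 - r m ^+ K))).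
  have : aX / alpha * r m * r m ^+ K <= aX / alpha * r m ^+ K.
    rewrite ler_wpM2r ?exprn_ge0 ?(ltW (r_gt0 m))//.
    by rewrite ler_piMr ?(ltW c0) ?(ltW (r_lt1 m)).
  by move: hm hK; rewrite -rE; lra.
have -> : b m * (1 - a m) * ((1 - r m ^+ K) / (1 - r m)) =
  b m * (1 - a m) / (1 - r m) * (1 - r m ^+ K) by ring.
by rewrite ler_wpM2r// subr_ge0.
Unshelve. all: by end_near. Qed.

(** The same scheme with limits h / (1 - r) and h r / (1 - r). In the upper
    bound the levels beyond K are controlled by [grid_tail]. *)
Lemma cvg_log_excess_sum :
  log_excess_sum x y n (t n) / v n @[n --> \oo] --> alpha^-1.
Proof.
have aV0 : 0 < alpha^-1 by rewrite invr_gt0.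
apply: cvg_of_asymptotic_bounds => e e0; have e20 : 0 < e / 2 by rewrite divr_gt0.
  have [m [hm _]] := fine_mesh_exists alpha alpha^-1 e20.
  have [w w01 tail] := grid_tail m; have [w0 w1] := andP w01.
  have [K hK] : exists K, mesh m * 2 / (1 - w) * w ^+ K < e / 2.
    by apply: pow_lt_exists => //; rewrite (ltW w0) w1.
  exists (fun n => mesh m * (\sum_(k < K) (D n (g m n k) (g m n k) / v n)) +
     mesh m * 2 / (1 - w) * w ^+ K).
  exists (mesh m * (\sum_(k < K) (a m ^+ k * b m ^+ k)) +
     mesh m * 2 / (1 - w) * w ^+ K); split.
  - near=> n; have tn : 0 < t n by near: n.
    have vn : 0 < v n by near: n.
    have tailn : forall k, D n (g m n k) (g m n k) <= 2 * w ^+ k * v n by near: n.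
    have [K0 HK0] := log_excess_sum_le tn (mesh_gt0 m) x y n.
    have := HK0 (K + K0)%N (leq_addl _ _).
    rewrite big_split_ord/= => le1.
    rewrite ler_pdivrMr// (le_trans le1)// mulrDr -mulr_suml.
    have -> S : (mesh m * (S / v n) + mesh m * 2 / (1 - w) * w ^+ K) * v n =
        mesh m * S + mesh m * (2 * w ^+ K * v n / (1 - w)).
      by field; rewrite !lt0r_neq0// subr_gt0.
    rewrite lerD2l.
    rewrite ler_wpM2l ?(ltW (mesh_gt0 m))//.
    apply: (@le_trans _ _ (\sum_(k < K0) (2 * w ^+ K * v n) * w ^+ k)).
      apply: ler_sum => k _.
      rewrite (_ : 2 * w ^+ K * v n * w ^+ k = 2 * w ^+ (K + k) * v n).
        exact: tailn.
      by rewrite exprD; ring.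
    rewrite -mulr_sumr.
    rewrite ler_wpM2l ?mulr_ge0 ?exprn_ge0 ?(ltW w0) ?(ltW vn)//.
    by apply: sum_geometric_le; rewrite (ltW w0).
  - apply: cvgD; last exact: cvg_cst.
    apply: cvgM; first exact: cvg_cst.
    apply: cvg_big => [|k _]; first exact: add_continuous.
    exact: grid_limit.
  have -> : alpha^-1 + e = alpha^-1 + e / 2 + e / 2 by lra.
  rewrite ltrD// (le_lt_trans _ hm)// -rV.
  under eq_bigr => k _ do rewrite -exprMn -/(r m).
  have := onem_expRN_ge (alpha * mesh m); rewrite -rE => h.
  apply: (@le_trans _ _ (mesh m * (1 - r m)^-1)).
    rewrite ler_wpM2l ?(ltW (mesh_gt0 m))// sum_geometric_le//.
    by rewrite (ltW (r_gt0 m)) r_lt1.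
  rewrite ler_pdivrMr// -invfM mulrC ler_pdivlMr ?(mulr_gt0 alpha0 (r_gt0 m))//.
  by rewrite mulrCA mulrA.
have [m [_ hm]] := fine_mesh_exists alpha alpha^-1 e20.
have [K hK] : exists K, alpha^-1 * r m ^+ K < e / 2.
  by apply: pow_lt_exists => //; rewrite (ltW (r_gt0 m)) r_lt1.
exists (fun n => mesh m * (\sum_(k < K) (D n (g m n k.+1) (g m n k.+1) / v n))).
exists (mesh m * (\sum_(k < K) (a m ^+ k.+1 * b m ^+ k.+1))); split.
- near=> n; have tn : 0 < t n by near: n.
  have vn : 0 < v n by near: n.
  rewrite -mulr_suml mulrA ler_pM2r ?invr_gt0//.
  by apply: log_excess_sum_ge => //; exact: mesh_gt0.
- apply: cvgM; first exact: cvg_cst.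
  apply: cvg_big => [|k _]; first exact: add_continuous.
  exact: grid_limit.
under eq_bigr => k _ do rewrite -exprMn -/(r m) exprS.
rewrite -mulr_sumr sum_r.
have rK1 : r m ^+ K <= 1 by rewrite exprn_ile1 ?(ltW (r_gt0 m)) ?(ltW (r_lt1 m)).
have key : alpha^-1 <= mesh m / (1 - r m).
  rewrite ler_pdivlMr// mulrC ler_pdivrMr// mulrC rE; exact: onem_expRN_le.
apply: (@lt_le_trans _ _ (alpha^-1 * (r m * (1 - r m ^+ K)))).
  have : alpha^-1 * r m * r m ^+ K <= alpha^-1 * r m ^+ K.
    rewrite ler_wpM2r ?exprn_ge0 ?(ltW (r_gt0 m))//.
    by rewrite ler_piMr ?(ltW aV0) ?(ltW (r_lt1 m)).
  by move: hm hK; rewrite -rE; lra.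
have -> : mesh m * (r m * ((1 - r m ^+ K) / (1 - r m))) =
  mesh m / (1 - r m) * (r m * (1 - r m ^+ K)) by ring.
by rewrite ler_wpM2r// mulr_ge0 ?subr_ge0 ?(ltW (r_gt0 m)).
Unshelve. all: by end_near. Qed.

End Limits.

(** * The integral of the empirical tail *)
Section LogIntegral.
Context (R : realType).
Let mu := @lebesgue_measure R.

Lemma measurable_inv_half_line (s : R) : 0 < s ->
  measurable_fun `[s, +oo[ (fun y : R => y^-1).
Proof.
move=> s0; apply: subspace_continuous_measurable_fun => //.
apply: continuous_in_subspaceT => y; rewrite inE/= in_itv/= andbT => sy.
by apply: inv_continuous; rewrite gt_eqF// (lt_le_trans s0).
Qed.

Lemma measurable_exceedance (z : R) (D : set R) :
  measurable_fun D (fun y : R => (y <= z)%R%:R : R).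
Proof.
rewrite (_ : (fun _ => _) = \1_`]-oo, z]); first exact: measurable_indic.
apply/funext => y; rewrite indicE; congr (nat_of_bool _)%:R.
by rewrite mem_setE in_itv.
Qed.

Lemma integral_exceedance (s z : R) : 0 < s ->
  (\int[mu]_(y in `[s, +oo[) ((y <= z)%R%:R / y)%:E = (log_excess s z)%:E)%E.
Proof.
move=> s0.
transitivity (\int[mu]_(y in `[s, +oo[) (((fun y => (y^-1)%:E) \_ `]-oo, z])
  y))%E.
  apply: eq_integral => y _; rewrite patchE mem_setE in_itv/=.
  by case: ifP; rewrite ?mul1r ?mul0r.
rewrite -integral_mkcondr /log_excess.
have -> : `[s, +oo[%classic `&` `]-oo, z]%classic = `[s, z]%classic.
  by apply/seteqP; split => y; rewrite /= !in_itv/= andbT;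
    [move=> [-> ->]|move=> /andP].
case: (ltgtP s z) => sz; last first.
- by rewrite sz set_itv1 integral_set1 divff ?gt_eqF ?ln1// -sz.
- by rewrite set_itv_ge ?integral_set0// bnd_simp -ltNge.
have z0 := lt_trans s0 sz.
rewrite ln_div ?posrE// EFinB; apply: continuous_FTC2 => //.
- apply: continuous_in_subspaceT => y; rewrite inE/= in_itv/= => /andP[sy _].
  by apply: inv_continuous; rewrite gt_eqF// (lt_le_trans s0).
- split.
  + move=> y; rewrite in_itv/= => /andP[sy _].
    by apply: ex_derive; apply: is_derive1_ln; exact: lt_trans sy.
  + by apply: cvg_at_right_filter; exact: continuous_ln.
  + by apply: cvg_at_left_filter; exact: continuous_ln.
- move=> y; rewrite in_itv/= => /andP[sy _].
  rewrite derive1E; have [_ ->//] := is_derive1_ln (lt_trans s0 sy).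
Qed.

Lemma Rintegral_exceedances (z : nat -> R) n (s : R) : 0 < s ->
  \int[mu]_(y in `[s, +oo[) (1 / n%:R * (\sum_(i < n) (y <= z i)%R%:R) / y) =
  1 / n%:R * \sum_(i < n) log_excess s (z i).
Proof.
move=> s0; rewrite /Rintegral.
have -> : (\int[mu]_(y in `[s, +oo[)
    (1 / n%:R * (\sum_(i < n) (y <= z i)%R%:R) / y)%:E)%E =
  (\int[mu]_(y in `[s, +oo[) ((1 / n%:R)%:E *
     \sum_(i < n) ((y <= z i)%R%:R / y)%:E))%E.
  apply: eq_integral => y _; rewrite sumEFin -EFinM; congr EFin.
  by rewrite -mulr_suml mulrA.
have f0 i y : `[s, +oo[%classic y -> (0 <= ((y <= z i)%R%:R / y)%:E)%E.
  rewrite /= in_itv/= andbT => sy; rewrite lee_fin divr_ge0//.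
  by rewrite ltW// (lt_le_trans s0).
have mf i : measurable_fun `[s, +oo[ (fun y : R => ((y <= z i)%R%:R / y)%:E).
  apply/measurable_EFinP; apply: measurable_funM.
    exact: measurable_exceedance.
  exact: measurable_inv_half_line.
rewrite ge0_integralZl//; last 2 first.
- by apply: emeasurable_sum => i; exact: mf.
- by move=> y ys; apply: sume_ge0 => i _; exact: f0.
rewrite ge0_integral_sum//; last 2 first.
- by move=> i; exact: mf.
- by move=> i y ys; exact: f0.
under eq_bigr => i _ do rewrite integral_exceedance//.
by rewrite sumEFin -EFinM.
Qed.

End LogIntegral.

(** * Growth of the threshold and decay of the lower bound on the ratio *)
Section Threshold.
Context (R : realType).

Lemma cvg_powRy (b : R) : 0 < b -> n%:R `^ b @[n --> \oo] --> +oo.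
Proof.
move=> b0; apply/cvgryPgt => A.
pose B := Num.max A 0 + 1.
have B0 : 0 < B by rewrite (@le_lt_trans _ _ (Num.max A 0)) ?le_max ?lexx
  ?orbT// ltrDl.
have AB : A < B by rewrite (@le_lt_trans _ _ (Num.max A 0)) ?le_max ?lexx// ltrDl.
near=> n.
have nB : B `^ b^-1 < n%:R by near: n; exact: nbhs_infty_gtr.
apply: (lt_trans AB).
have -> : B = (B `^ b^-1) `^ b by rewrite -powRrM mulVf ?gt_eqF// powRr1// ltW.
by rewrite gt0_ltr_powR// ?nnegrE ?powR_ge0.
Unshelve. all: by end_near. Qed.

Lemma H_seq_lt (e : R) : 0 < e -> \forall n \near \oo, H_seq R n < e.
Proof.
move=> e0; near=> n.
have nM : expR (expR e^-1) < n%:R by near: n; exact: nbhs_infty_gtr.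
have n0 : 0 < n%:R :> R by rewrite (lt_trans _ nM)// expR_gt0.
have l1 : expR e^-1 < ln n%:R by rewrite -ltr_expR lnK.
have l0 : 0 < ln (n%:R : R) by rewrite (lt_trans _ l1)// expR_gt0.
have l2 : e^-1 < ln (ln n%:R) by rewrite -ltr_expR lnK.
rewrite /H_seq div1r -[e]invrK ltf_pV2 ?posrE ?invr_gt0//.
by rewrite (lt_trans _ l2)// invr_gt0.
Unshelve. all: by end_near. Qed.

End Threshold.

(** * Consistency of the estimator *)
Section Assembly.
Context d (T : measurableType d) (R : realType) (P : probability T R).
Variables (X Y : nat -> {RV P >-> R}) (a alphaX alphaY gamma0 beta c : R).
Variables (LX LY : R -> R).
Hypothesis hA1 : A1 X Y a alphaX alphaY LX LY.
Hypothesis hA2 : A2 a LX LY.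
Hypothesis hA3 : A3 gamma0 alphaX alphaY.
Hypothesis hbeta : 0 < beta < gamma0 / 2.
Hypothesis hc : beta / gamma0 < c < 1 / 2.

Let alpha := alphaX + alphaY.
Let t := @threshold R beta.
Let SX := survival (X 0%N).
Let SY := survival (Y 0%N).
Let p := SX \* SY.
Let v n := n%:R * p (t n).
Let count w := quadrant_count (X^~ w) (Y^~ w).

Let alphaX_gt0 : 0 < alphaX. Proof. by case: hA1 => _ _ _ [_ []]. Qed.
Let alphaY_gt0 : 0 < alphaY. Proof. by case: hA1 => _ _ _ [_ _ []]. Qed.
Let alpha_gt0 : 0 < alpha. Proof. exact: addr_gt0. Qed.
Let beta_gt0 : 0 < beta. Proof. by case/andP: hbeta. Qed.

Let rvX : regularly_varying SX alphaX.
Proof.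
have [_ _ _ [a0 rX _]] := hA1; apply: survival_regularly_varying rX _ => // x ax.
by have [/(_ _ ax)[]] := hA2.
Qed.

Let rvY : regularly_varying SY alphaY.
Proof.
have [_ _ _ [a0 _ rY]] := hA1; apply: survival_regularly_varying rY _ => // x ax.
by have [/(_ _ ax)[]] := hA2.
Qed.

Let rvp : regularly_varying p alpha. Proof. exact: regularly_varyingM. Qed.

Let t_cvg : t n @[n --> \oo] --> +oo. Proof. exact: cvg_powRy. Qed.

Let p_gt0 x : 0 < p x. Proof. by case: rvp. Qed.

Let v_gt0 : \forall n \near \oo, 0 < v n.
Proof.
by near=> n; rewrite mulr_gt0// ltr0n; near: n; exists 1%N.
Unshelve. all: by end_near. Qed.

Let t_gt0 : \forall n \near \oo, 0 < t n.
Proof.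
by near=> n; rewrite powR_gt0// ltr0n; near: n; exists 1%N.
Unshelve. all: by end_near. Qed.

(* Each of alphaX and alphaY is at most 1 / (2 gamma0). *)
Let beta_alpha : beta * alpha < c.
Proof.
have [g0 gX gY] := hA3; have /andP[+ _] := hc; apply: le_lt_trans.
rewrite ler_pM2l// /alpha.
have aux b : 0 < b -> 2 * gamma0 <= tail_index b -> b <= gamma0^-1 / 2.
  move=> b0; rewrite /tail_index div1r => h.
  by rewrite -invfM -[b]invrK lef_pV2 ?posrE ?invr_gt0 ?mulr_gt0// mulrC.
by have := aux _ alphaX_gt0 gX; have := aux _ alphaY_gt0 gY; lra.
Qed.

(** The exponent alpha' lies strictly between alpha and c / beta, so that
    p(t_n) >= C n^(- beta alpha') outgrows n^-c. The factor 2 leaves room for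
    phat, which is eventually at least half of p. *)
Lemma floor_level_le : \forall n \near \oo, 2 * floor_level c n <= p (t n).
Proof.
pose alpha' := (alpha + c / beta) / 2.
have aa : alpha < alpha'.
  by rewrite /alpha' ltr_pdivlMr// mulr_natr mulr2n ltrD2l ltr_pdivlMr// mulrC.
have ac : beta * alpha' < c.
  rewrite mulrC -ltr_pdivlMr// /alpha' ltr_pdivrMr// mulr_natr mulr2n ltrD2r.
  by rewrite ltr_pdivlMr// mulrC.
have [C C0 HC] := regularly_varying_lower rvp alpha_gt0 aa.
have HCt : \forall n \near \oo, C * t n `^ (- alpha') <= p (t n).
  exact: t_cvg HC.
have pw : n%:R `^ (c - beta * alpha') @[n --> \oo] --> +oo.
  by apply: cvg_powRy; rewrite subr_gt0.
have near2 : \forall n \near \oo, 2 / C < n%:R `^ (c - beta * alpha').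
  by move/cvgryPgt : pw.
near=> n; have n0 : (0 < n)%N by near: n; exists 1%N.
apply: (@le_trans _ _ (C * t n `^ (- alpha'))); last by near: n.
rewrite /floor_level /t /threshold -powRrM.
have -> : beta * - alpha' = (c - beta * alpha') + - c by ring.
rewrite powRD; last by rewrite (_ : n%:R != 0) ?implybT// pnatr_eq0 -lt0n.
rewrite mulrA ler_wpM2r ?powR_ge0//.
by rewrite mulrC -ler_pdivrMr// ltW//; near: n.
Unshelve. all: by end_near. Qed.

Let sigma_gt : 1 / 2 < 1 - c.
Proof. by have /andP[_] := hc; lra. Qed.

Let many : \forall n \near \oo, n%:R `^ (1 - c) <= n%:R * (SX (t n) * SY (t n)).
Proof.
near=> n; have n0 : (0 < n)%N by near: n; exists 1%N.
rewrite powRD; last by rewrite (_ : n%:R != 0) ?implybT// pnatr_eq0 -lt0n.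
rewrite powRr1// ler_wpM2l//.
have fl : 2 * floor_level c n <= p (t n) by near: n; exact: floor_level_le.
by apply: le_trans fl; rewrite ler_peMl ?powR_ge0// ler1n.
Unshelve. all: by end_near. Qed.

Let survival_grid_limit h j k : 0 < h ->
  SX (t n * expR (j%:R * h)) * SY (t n * expR (k%:R * h)) / p (t n)
    @[n --> \oo] --> expR (- (alphaX * h)) ^+ j * expR (- (alphaY * h)) ^+ k.
Proof.
move=> h0; have [_ _ limX] := rvX; have [_ _ limY] := rvY.
have aux b i : expR (i%:R * h) `^ (- b) = expR (- (b * h)) ^+ i.
  by rewrite -expRM -expRM_natl; congr expR; ring.
have lim : (SX (expR (j%:R * h) * x) / SX x) * (SY (expR (k%:R * h) * x) / SY x)
    @[x --> +oo] --> expR (- (alphaX * h)) ^+ j * expR (- (alphaY * h)) ^+ k.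
  by rewrite -!aux; apply: cvgM; [apply: limX|apply: limY]; rewrite expR_gt0.
apply: cvg_trans (cvg_comp _ _ t_cvg lim).
apply: near_eq_cvg; apply: nearW => n /=.
by rewrite ![t n * _]mulrC /p/= invfM mulrACA.
Qed.

Lemma ae_grid_limit : {ae P, forall w, forall m j k,
  count w n (t n * expR (j%:R * mesh R m)) (t n * expR (k%:R * mesh R m)) / v n
    @[n --> \oo] -->
  expR (- (alphaX * mesh R m)) ^+ j * expR (- (alphaY * mesh R m)) ^+ k}.
Proof.
have [idX idY indXY _] := hA1.
apply: ae_foralln => m; apply: ae_foralln => j; apply: ae_foralln => k.
set s := fun n => t n * expR (j%:R * mesh R m).
set s' := fun n => t n * expR (k%:R * mesh R m).
have ts : \forall n \near \oo, t n <= s n /\ t n <= s' n.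
  near=> n; have tn : 0 < t n by near: n.
  by rewrite /s /s' !ler_peMr ?(ltW tn)// -expR0 ler_expR mulr_ge0// ltW//
    mesh_gt0.
have : {ae P, forall w, forall l, \forall n \near \oo,
    `|count w n (s n) (s' n) - n%:R * (SX (s n) * SY (s' n))| <
    l.+1%:R^-1 * (n%:R * (SX (t n) * SY (t n)))}.
  apply: ae_foralln => l.
  exact: (count_lln idX idY indXY sigma_gt many).
apply: filterS => w dev.
have lim := @survival_grid_limit (mesh R m) j k (mesh_gt0 R m).
have dif : count w n (s n) (s' n) / v n - SX (s n) * SY (s' n) / p (t n)
    @[n --> \oo] --> 0.
  apply/cvgr0Pnorm_lt => e e0.
  have [l le] : exists l, l.+1%:R^-1 < e.
    exists (Num.truncn e^-1); rewrite invf_plt ?posrE//.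
    by rewrite truncnS_gt.
  near=> n; have vn : 0 < v n by near: n.
  have devn : `|count w n (s n) (s' n) - n%:R * (SX (s n) * SY (s' n))| <
    l.+1%:R^-1 * (n%:R * (SX (t n) * SY (t n))) by near: n; exact: dev.
  have n0 : n%:R != 0 :> R.
    by apply: contraTneq vn; rewrite /v => ->; rewrite mul0r ltxx.
  rewrite (_ : _ - _ = (count w n (s n) (s' n) - n%:R * (SX (s n) * SY (s' n)))
    / v n).
    rewrite normf_div (gtr0_norm vn) ltr_pdivrMr// (lt_trans devn)//.
    by rewrite ltr_pM2r.
  by rewrite /v; field; rewrite n0 lt0r_neq0.
have := cvgD dif lim; rewrite add0r => lim2.
under eq_cvg => n do
  rewrite -[_ / v n](subrK (SX (s n) * SY (s' n) / p (t n))).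
exact: lim2.
Unshelve. all: by end_near. Qed.

Lemma ae_grid_tail : {ae P, forall w, forall m, exists2 w0, 0 < w0 < 1 &
  \forall n \near \oo, forall k,
  count w n (t n * expR (k%:R * mesh R m)) (t n * expR (k%:R * mesh R m))
    <= 2 * w0 ^+ k * v n}.
Proof.
have [idX idY indXY _] := hA1.
apply: ae_foralln => m; have h0 := mesh_gt0 R m; set h := mesh R m in h0 *.
(* Any w0 in ]0, 1[ with e^(- alpha h) < w0^5 would do. *)
pose w0 := expR (- (alpha * h / 8)).
have w01 : 0 < w0 < 1.
  by rewrite expR_gt0/= -expR0 ltr_expR oppr_lt0 divr_gt0// mulr_gt0.
have w05 : expR (- (alpha * h)) < w0 ^+ 5.
  rewrite -expRM_natl ltr_expR; have := mulr_gt0 alpha_gt0 h0.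
  by set q := alpha * h; lra.
have dec := regularly_varying_geometric rvp h0 w05.
have dect : \forall n \near \oo, forall k,
    SX (t n * expR (k%:R * h)) * SY (t n * expR (k%:R * h)) <=
    (w0 ^+ 5) ^+ k * (SX (t n) * SY (t n)) by exact: t_cvg dec.
have := count_decay idX idY indXY sigma_gt many w01 dect.
by apply: filterS => w hw; exists w0.
Qed.

Let estimator w n := zetahat X Y t (floor_level c) n w /
       rhohat X Y t (floor_level c) n w *
       (H_seq R n <= rhohat X Y t (floor_level c) n w)%R%:R.

Lemma estimator_cvg w :
  (forall m j k,
    count w n (t n * expR (j%:R * mesh R m)) (t n * expR (k%:R * mesh R m)) / v n
      @[n --> \oo] -->
    expR (- (alphaX * mesh R m)) ^+ j * expR (- (alphaY * mesh R m)) ^+ k) ->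
  (forall m, exists2 w0, 0 < w0 < 1 & \forall n \near \oo, forall k,
    count w n (t n * expR (k%:R * mesh R m)) (t n * expR (k%:R * mesh R m))
      <= 2 * w0 ^+ k * v n) ->
  estimator w n @[n --> \oo] --> tail_index alphaX.
Proof.
move=> grid_limit grid_tail.
pose x := X^~ w; pose y := Y^~ w.
have limN := cvg_exceedance_count grid_limit.
have limM := cvg_uncensored_count alphaX_gt0 alphaY_gt0 t_gt0 v_gt0 grid_limit.
have limL := cvg_log_excess_sum alphaX_gt0 alphaY_gt0 t_gt0 v_gt0 grid_limit
  grid_tail.
rewrite -/(x) -/(y) in limN limM limL.
set N := fun n => quadrant_count x y n (t n) (t n) in limN.
set M := fun n => uncensored_count x y n (t n) in limM.
set L := fun n => log_excess_sum x y n (t n) in limL.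
have phatE n : phat X Y n (t n) w = 1 / n%:R * N n.
  by rewrite /N quadrant_count_diag.
have ratio_gt0 : 0 < alphaX / (alphaX + alphaY) by rewrite divr_gt0.
have limR : (M n / v n) / (N n / v n) @[n --> \oo] --> alphaX / (alphaX + alphaY).
  rewrite -[X in _ --> X]divr1; apply: cvgM; first exact: limM.
  by apply: cvgV => //; exact: oner_neq0.
have limQ : (L n / v n) / (M n / v n) @[n --> \oo] --> tail_index alphaX.
  have -> : tail_index alphaX =
      (alphaX + alphaY)^-1 / (alphaX / (alphaX + alphaY)).
    by rewrite /tail_index; field; rewrite !lt0r_neq0.
  apply: cvgM; first exact: limL.
  by apply: cvgV; [rewrite lt0r_neq0|exact: limM].
(* Eventually both indicators are 1, and the estimator is exactly L / M. *)
apply: cvg_trans limQ; apply: near_eq_cvg.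
have half_lt : 1 / 2 < 1 :> R by lra.
have nearN : \forall n \near \oo, 1 / 2 < N n / v n by exact: cvgr_gt half_lt.
have nearM : \forall n \near \oo, 0 < M n / v n by exact: cvgr_gt ratio_gt0.
have r20 : 0 < alphaX / (alphaX + alphaY) / 2 by rewrite divr_gt0.
have r21 : alphaX / (alphaX + alphaY) / 2 < alphaX / (alphaX + alphaY).
  by rewrite ltr_pdivrMr// ltr_pMr// ltr1n.
have nearR : \forall n \near \oo, alphaX / (alphaX + alphaY) / 2 <
   (M n / v n) / (N n / v n) by exact: cvgr_gt r21.
have nearH := H_seq_lt r20.
near=> n.
have n0 : 0 < n%:R :> R by rewrite ltr0n; near: n; exists 1%N.
have tn : 0 < t n by near: n.
have vn : 0 < v n by near: n.
have Nn : 1 / 2 < N n / v n by near: n.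
have Mn : 0 < M n / v n by near: n.
have Rn : alphaX / (alphaX + alphaY) / 2 < (M n / v n) / (N n / v n) by near: n.
have Hn : H_seq R n < alphaX / (alphaX + alphaY) / 2 by near: n.
have fn : 2 * floor_level c n <= p (t n) by near: n; exact: floor_level_le.
have N0 : 0 < N n.
  by have : 0 < N n / v n by [exact: lt_trans Nn]; rewrite pmulr_lgt0 ?invr_gt0.
have M0 : 0 < M n by move: Mn; rewrite pmulr_lgt0 ?invr_gt0.
have phat_ge : floor_level c n <= phat X Y n (t n) w.
  rewrite phatE; have -> : 1 / n%:R * N n = p (t n) * (N n / v n).
    by rewrite /v; field; rewrite !lt0r_neq0.
  have := p_gt0 (t n); nra.
have rhoE : rhohat X Y t (floor_level c) n w = (M n / v n) / (N n / v n).
  rewrite /rhohat phat_ge mulr1 phatE.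
  have -> : qhat X Y n (t n) w = 1 / n%:R * M n by [].
  by field; rewrite !lt0r_neq0.
have zetaE : zetahat X Y t (floor_level c) n w = (L n / v n) / (N n / v n).
  have intE : \int[lebesgue_measure]_(y in `[t n, +oo[) (phat X Y n y w / y) =
    1 / n%:R * L n.
    exact: (Rintegral_exceedances (fun i => Num.min (X i w) (Y i w)) n tn).
  rewrite /zetahat phat_ge intE phatE -[true%:R]/(1 : R).
  by field; rewrite !lt0r_neq0.
rewrite /estimator rhoE zetaE (le_trans (ltW Hn) (ltW Rn)) mulr1.
by field; rewrite !lt0r_neq0.
Unshelve. all: by end_near. Qed.

End Assembly.

Unset Implicit Arguments.

Theorem theorem2 (d : measure_display) (T : measurableType d) (R : realType)
    (P : probability T R) (X Y : nat -> {RV P >-> R})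
    (a alphaX alphaY gamma0 beta c : R) (LX LY : R -> R)
    (hA1 : A1 X Y a alphaX alphaY LX LY)
    (hA2 : A2 a LX LY)
    (hA3 : A3 gamma0 alphaX alphaY)
    (hbeta : 0 < beta < gamma0 / 2)
    (hc : beta / gamma0 < c < 1 / 2) :
  {ae P, forall w,
    (fun n : nat =>
       zetahat X Y (threshold beta) (floor_level c) n w /
       rhohat X Y (threshold beta) (floor_level c) n w *
       (H_seq R n <= rhohat X Y (threshold beta) (floor_level c) n w)%R%:R)
      @ \oo --> tail_index alphaX}.
Proof.
have grid := ae_grid_limit hA1 hA2 hA3 hbeta hc.
have tail := ae_grid_tail hA1 hA2 hA3 hbeta hc.
apply: filterS2 grid tail => w gridw tailw.
exact: (estimator_cvg hA1 hA2 hA3 hbeta hc gridw tailw).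
Qed.
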